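(* Let $d\geq 2$ be an integer, let $P_d:=\operatorname{conv}\big(\tfrac{2d+2}{d-1}\Delta_d \cup (d+1)(-\Delta_d)\big)\subseteq W_{d+1}$, and let $P_d^*$ be its polar in $W_{d+1}$. Let $\operatorname{VOL}_{d,d+1}\subseteq\mathbb{R}^{d+1}$ be the set of facet volume vectors of all $d$-dimensional simplices in $\mathbb{R}^d$. Then \[ \operatorname{VOL}_{d,d+1}\cap H_{d+1} = \operatorname{relint} (P_d^* ) + \tfrac1{d+1}e \qquad\text{and}\qquad \operatorname{VOL}_{d,d+1}= \operatorname{cone} \big( \operatorname{relint} (P_d^* ) + \tfrac1{d+1}e\big)\setminus\{0\}. \]
   Context: $\operatorname{VOL}_{d,d+1}$ is the set of all vectors $(\operatorname{vol}_{d-1}(F_1),\dots,\operatorname{vol}_{d-1}(F_{d+1}))$, where $(x_1,\dots,x_{d+1})$ ranges over all $(d+1)$-tuples of affinely independent points in $\mathbb{R}^d$ and $F_i=\operatorname{conv}(\{x_1,\dots,x_{d+1}\}\setminus\{x_i\})$ is the facet opposite to $x_i$. Let $e_1,\dots,e_{d+1}$ be the standard basis of $\mathbb{R}^{d+1}$ and $e:=\sum_{i=1}^{d+1}e_i$. $W_{d+1}:=\{\lambda\in\mathbb{R}^{d+1}:\sum_i\lambda_i=0\}$ and $H_{d+1}:=\{\alpha\in\mathbb{R}^{d+1}:\sum_i\alpha_i=1\}$. $\Delta_d:=\operatorname{conv}\{e_1-\tfrac1{d+1}e,\dots,e_{d+1}-\tfrac1{d+1}e\}\subseteq W_{d+1}$.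 With $\langle\cdot,\cdot\rangle$ the standard scalar product, the polar of a set $P\subseteq W_{d+1}$ in $W_{d+1}$ is $P^*:=\{y\in W_{d+1}:\langle x,y\rangle\leq 1\text{ for all }x\in P\}$. $\operatorname{relint}$ denotes relative interior, and $\operatorname{cone}(A)$ denotes the set of all finite linear combinations of elements of $A$ with nonnegative coefficients. *)

(* Defs.v *)
From HB Require Import structures.
From mathcomp Require Import all_boot all_order all_algebra.
From mathcomp Require Import all_classical all_reals all_analysis.

Set Implicit Arguments.
Unset Strict Implicit.
Unset Printing Implicit Defensive.

Import Order.TTheory GRing.Theory Num.Theory.
Import numFieldNormedType.Exports.

Local Open Scope classical_set_scope.
Local Open Scope ring_scope.

Section tuple_cons_measure.
Context {d : measure_display} {T : measurableType d} {R : realType} {n : nat}.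
Variables (m1 : {sigma_finite_measure set T -> \bar R})
  (m2 : {sigma_finite_measure set (n.-tuple T) -> \bar R}).

Definition tuple_cons (p : T * n.-tuple T) : n.+1.-tuple T :=
  [tuple of p.1 :: p.2].

Lemma measurable_tuple_cons : measurable_fun setT tuple_cons.
Proof. exact: measurable_cons. Qed.

Definition tuple_cons_measure : set (n.+1.-tuple T) -> \bar R :=
  pushforward (m1 \x m2)%E tuple_cons.

Let tuple_cons_measure0 : tuple_cons_measure set0 = 0%E.
Proof. by rewrite /tuple_cons_measure /pushforward preimage_set0 measure0. Qed.

Let tuple_cons_measure_ge0 A : (0 <= tuple_cons_measure A)%E.
Proof. by rewrite /tuple_cons_measure /pushforward; exact: measure_ge0. Qed.

Let tuple_cons_measure_sigma_additive :
  semi_sigma_additive tuple_cons_measure.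
Proof.
move=> F mF tF mUF; rewrite /tuple_cons_measure /pushforward preimage_bigcup.
apply: measure_semi_sigma_additive.
- move=> i; rewrite -[X in measurable X]setTI.
  by apply: measurable_tuple_cons => //; exact: mF.
- apply/trivIsetP => /= i j _ _ ij; rewrite -preimage_setI.
  by move/trivIsetP : tF => /(_ _ _ _ _ ij) ->//; rewrite preimage_set0.
- rewrite -preimage_bigcup -[X in measurable X]setTI.
  exact: measurable_tuple_cons.
Qed.

HB.instance Definition _ := isMeasure.Build _ _ _ tuple_cons_measure
  tuple_cons_measure0 tuple_cons_measure_ge0 tuple_cons_measure_sigma_additive.

Let tuple_cons_measure_sigma_finite : sigma_finite setT tuple_cons_measure.
Proof.
have /sigma_finiteP[F [TF ndF Foo]] := sigma_finiteT m1.
have /sigma_finiteP[G [TG ndG Goo]] := sigma_finiteT m2.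
pose g (t : n.+1.-tuple T) := (thead t, [tuple of behead t]).
have mg : measurable_fun setT g.
  apply/measurable_fun_pair; first exact: measurable_tnth.
  exact: measurable_behead.
have gK : cancel tuple_cons g.
  by case=> a b; congr (_, _); apply/val_inj.
exists (fun i => g @^-1` (F i `*` G i)).
  apply/esym; rewrite -subTset => t _.
  have [i _ Fi] : (\bigcup_i F i) (g t).1 by rewrite -TF.
  have [j _ Gj] : (\bigcup_i G i) (g t).2 by rewrite -TG.
  exists (maxn i j) => //; split.
    by move: Fi; exact/subsetPset/ndF/leq_maxl.
  by move: Gj; exact/subsetPset/ndG/leq_maxr.
move=> i; have [mF Fi] := Foo i; have [mG Gi] := Goo i; split.
  by rewrite -[_ @^-1` _]setTI; apply: mg => //; exact: measurableX.
rewrite /tuple_cons_measure /pushforward -comp_preimage.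
rewrite (_ : g \o tuple_cons = id); last by apply/funext => x /=; rewrite gK.
by rewrite preimage_id product_measure1E// lte_mul_pinfty// ge0_fin_numE.
Qed.

HB.instance Definition _ := Measure_isSigmaFinite.Build _ _ _
  tuple_cons_measure tuple_cons_measure_sigma_finite.

End tuple_cons_measure.

(* n-dimensional Lebesgue measure, as the n-fold product of the
   one-dimensional one. *)
Fixpoint lebesgue_measure_tuple (R : realType) (n : nat) :
    {sigma_finite_measure set (n.-tuple (measurableTypeR R)) -> \bar R} :=
  if n is n'.+1 then
    tuple_cons_measure (@lebesgue_measure R) (lebesgue_measure_tuple R n')
  else @dirac _ _ [tuple] R.

Unset Implicit Arguments.

Section convex_geometry.
Context {R : realType}.

Definition convex_hull {V : lmodType R} (A : set V) : set V :=
  smallest (@convex_set R V) A.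

Definition affine_hull {V : lmodType R} (A : set V) : set V :=
  [set v | exists m (x : 'I_m -> V) (c : 'I_m -> R),
    [/\ forall i, A (x i), \sum_i c i = 1 & v = \sum_i c i *: x i]].

Definition cone {V : lmodType R} (A : set V) : set V :=
  [set v | exists m (x : 'I_m -> V) (c : 'I_m -> R),
    [/\ forall i, A (x i), forall i, 0 <= c i & v = \sum_i c i *: x i]].

Definition affinely_independent {V : lmodType R} {m} (x : 'I_m -> V) : Prop :=
  forall c : 'I_m -> R,
    \sum_i c i = 0 -> \sum_i c i *: x i = 0 -> forall i, c i = 0.

(* Points outside [affine_hull A] are isolated in the library's subspace
   topology, which is harmless since [interior A `<=` A `<=` affine_hull A]. *)
Definition relint {n} (A : set 'rV[R]_n) : set 'rV[R]_n :=
  @interior (subspace (affine_hull A)) A.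

Definition dotrv {n} (x y : 'rV[R]_n) : R := \sum_i x 0 i * y 0 i.

(* k-dimensional volume of a subset of a k-dimensional flat of R^n: the
   Lebesgue measure of its preimage under an isometric affine chart
   [u |-> p + u *m Q] of R^k onto that flat (the rows of Q are orthonormal).
   Lebesgue measure being invariant under isometries of R^k, all charts give
   the same value for a measurable set, and the infimum merely selects it. *)
Definition flat_volume k {n} (S : set 'rV[R]_n) : \bar R :=
  ereal_inf [set v | exists (p : 'rV[R]_n) (Q : 'M[R]_(k, n)),
    [/\ Q *m Q^T = 1%:M,
        S `<=` range (fun u : 'rV[R]_k => p + u *m Q) &
        v = lebesgue_measure_tuple R k
              [set t | S (p + (\row_j tnth t j) *m Q)]]].

Definition facet {d} (x : 'I_d.+1 -> 'rV[R]_d) (i : 'I_d.+1) : set 'rV[R]_d :=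
  convex_hull (range x `\ x i).

Definition VOL d : set 'rV[R]_d.+1 :=
  [set a | exists2 x : 'I_d.+1 -> 'rV[R]_d, affinely_independent x &
    forall i, flat_volume d.-1 (facet x i) = (a 0 i)%:E].

Definition hyperplaneW n : set 'rV[R]_n := [set a | \sum_i a 0 i = 0].

Definition hyperplaneH n : set 'rV[R]_n := [set a | \sum_i a 0 i = 1].

(* (d+1)^-1 e *)
Definition barycenter d : 'rV[R]_d.+1 := const_mx d.+1%:R^-1.

Definition Delta d : set 'rV[R]_d.+1 :=
  convex_hull (range (fun i : 'I_d.+1 => delta_mx 0 i - barycenter d)).

Definition polarW {n} (P : set 'rV[R]_n) : set 'rV[R]_n :=
  [set y | hyperplaneW n y /\ forall x, P x -> dotrv x y <= 1].

Definition polytopeP d : set 'rV[R]_d.+1 :=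
  convex_hull (
    [set ((2 * d + 2)%:R / (d%:R - 1)) *: x | x in Delta d] `|`
    [set d.+1%:R *: (- x) | x in Delta d]).

End convex_geometry.

(* Main.v *)
(* If [g_i] is the gradient of the [i]-th barycentric coordinate of a simplex,
   the volume of the facet opposite to the [i]-th vertex is proportional to
   [|g_i|], with a factor independent of [i]. The [g_i] sum to zero and span the
   space, and every such family comes from a simplex. Hence, up to scaling, the
   facet volume vectors are the vectors of side lengths of closed polygons with
   [d + 1] sides spanning [R^d], that is, the positive vectors each of whose
   entries is smaller than the sum of the others. When they sum to 1 this is
   [0 < a_i < 1/2], which are the strict forms of the inequalities defining the
   translate of the polar of [P_d].
   The factor contains the volume of the standard simplex, of which only
   positivity and finiteness matter. *)
Require Import Defs.
From mathcomp Require Import all_boot all_order all_algebra perm.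
From mathcomp Require Import all_classical all_reals all_analysis.
From mathcomp Require Import measurable_realfun ring lra.

Set Implicit Arguments.
Unset Strict Implicit.
Unset Printing Implicit Defensive.

Import Order.TTheory GRing.Theory Num.Theory.
Import numFieldNormedType.Exports.

Local Open Scope classical_set_scope.
Local Open Scope ring_scope.

(** * Lebesgue measure of affine images *)

(** The proportionality is base times height: the height of the simplex over its i-th facet is
    1/|g_i|, while its volume is a constant times the determinant of the vertices written in
    homogeneous coordinates. The measure theory needed for this is the scaling of volume by |det|
    under affine maps. The g_i are read off the inverse of the same matrix, and inverting back turns
    a closed spanning family into a simplex. The obstacle in realizing prescribed side lengths is
    that the polygon must span the whole of R^d. It is therefore built by folding: a diagonal cuts
    off a triangle on two of the sides, and the apex of this triangle is raised into a new
    dimension. Each fold adds one side and one dimension, and the strict inequalities leave room for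
    a nondegenerate triangle every time. *)

Section lebesgue_measure_affine.
Context {R : realType}.
Notation mu := (@lebesgue_measure R).

Let measurable_affine (a b : R) :
  measurable_fun setT (fun x : measurableTypeR R => x * a + b : measurableTypeR R).
Proof. by apply: measurable_funD => //; apply: measurable_funM. Qed.

(** The pushforward of [mu] scaled by [a] agrees with [mu] on half-open intervals, and these
    determine Lebesgue measure. *)
Let affine_pos (a b : R) (S : set (measurableTypeR R)) : 0 < a ->
  measurable S -> mu [set x | S (x * a + b)] = (a^-1%:E * mu S)%E.
Proof.
move=> a0 mS; pose f (x : measurableTypeR R) : measurableTypeR R := x * a + b.
have a'0 : 0 <= a by exact: ltW.
pose nu : {measure set (measurableTypeR R) -> \bar R} :=
  mscale (NngNum a'0) (pushforward mu f : {measure set _ -> \bar R}).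
have mf : measurable_fun setT f by exact: measurable_affine.
suff -> : mu S = nu mf S.
  rewrite /nu /= /mscale/= muleA -EFinM mulVf ?gt_eqF// mul1e.
  by [].
apply: lebesgue_measure_unique => //= _ [[u v] _ <-].
change (mu `]u, v]%classic = (a%:E * mu (f @^-1` `]u, v]%classic))%E).
rewrite (_ : f @^-1` _ = `](u - b) / a, (v - b) / a]%classic); last first.
  apply/seteqP; split => x; rewrite /f /= !in_itv/= ltr_pdivrMr// ler_pdivlMr//.
    by rewrite ltrBlDr lerBrDr.
  by rewrite ltrBlDr lerBrDr.
rewrite !lebesgue_measure_itv/= !lte_fin ltr_pdivrMr// divfK ?gt_eqF//.
rewrite ltrD2r; case: ifPn => uv; last by rewrite mule0.
by rewrite !EFinN -!EFinB -EFinM -mulrBl mulrCA divff ?gt_eqF// mulr1; congr (_%:E); ring.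
Qed.

Lemma lebesgue_measure_affine (a b : R) (S : set (measurableTypeR R)) :
  a != 0 -> measurable S ->
  mu [set x | S (x * a + b)] = (`|a|^-1%:E * mu S)%E.
Proof.
move=> a0 mS; case: (ltgtP a 0) a0 => // a0 _; last first.
  by rewrite affine_pos// gtr0_norm.
have na0 : 0 < - a by rewrite oppr_gt0.
rewrite ltr0_norm// -(affine_pos b na0 mS).
rewrite -[RHS]lebesgue_measureN; last first.
  by rewrite -[X in measurable X]setTI; exact: (measurable_affine (- a) b).
rewrite /pushforward; congr (mu _); apply/seteqP; split => x /=.
  by rewrite mulrNN.
by rewrite mulrNN.
Qed.

End lebesgue_measure_affine.

(** * Volume under affine maps in dimension n *)

Section volume.
Context {R : realType}.
Notation mu := (@lebesgue_measure R).

Definition row_of_tuple n (t : n.-tuple R) : 'rV[R]_n := \row_j tnth t j.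

Definition row_measurable n (S : set 'rV[R]_n) :=
  measurable (@row_of_tuple n @^-1` S : set (n.-tuple (measurableTypeR R))).

Definition volume n (S : set 'rV[R]_n) : \bar R :=
  lebesgue_measure_tuple R n (@row_of_tuple n @^-1` S).

Lemma measurable_row_coord n (j : 'I_n) :
  measurable_fun setT
    (fun t : n.-tuple (measurableTypeR R) => row_of_tuple t 0 j : measurableTypeR R).
Proof.
rewrite (_ : (fun _ => _) = (@tnth _ (measurableTypeR R) ^~ j)); last first.
  by apply/funext => t; rewrite mxE.
exact: measurable_tnth.
Qed.

Lemma measurable_row_affine n m (A : 'M[R]_(n, m)) (p : 'rV[R]_m) (j : 'I_m) :
  measurable_fun setT (fun t : n.-tuple (measurableTypeR R) =>
    (row_of_tuple t *m A + p) 0 j : measurableTypeR R).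
Proof.
rewrite (_ : (fun _ => _) = (fun t : n.-tuple (measurableTypeR R) =>
  \sum_(i < n) (row_of_tuple t 0 i * A i j) + p 0 j)); last first.
  by apply/funext => t; rewrite !mxE.
apply: measurable_funD => //; apply: measurable_sum => i.
by apply: measurable_funM => //; exact: measurable_row_coord.
Qed.

Lemma row_measurable_affine n m (A : 'M[R]_(n, m)) (p : 'rV[R]_m) S :
  row_measurable S -> row_measurable [set v | S (v *m A + p)].
Proof.
move=> mS.
pose F (t : n.-tuple (measurableTypeR R)) : m.-tuple (measurableTypeR R) :=
  [tuple (row_of_tuple t *m A + p) 0 j | j < m].
have mF : measurable_fun setT F.
  apply/measurable_fun_tnthP => j.
  rewrite (_ : _ \o F = (fun t => (row_of_tuple t *m A + p) 0 j)).
    exact: measurable_row_affine.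
  by apply/funext => t /=; rewrite tnth_mktuple.
rewrite /row_measurable (_ : _ @^-1` _ = F @^-1` (@row_of_tuple m @^-1` S)).
  by rewrite -[X in measurable X]setTI; exact: mF.
apply/seteqP; split => t /=; rewrite (_ : row_of_tuple (F t) = row_of_tuple t *m A + p)//;
  by apply/rowP => j; rewrite !mxE tnth_mktuple !mxE.
Qed.

(** Typed in dimension [1 + n], which is convertible to [n.+1], so that block matrices act on head
    and tail. *)
Definition row_cons n (x : R) (v : 'rV[R]_n) : 'rV[R]_(1 + n) := row_mx x%:M v.

Lemma row_of_tuple_cons n (x : R) (t : n.-tuple R) :
  row_of_tuple [tuple of x :: t] = row_cons x (row_of_tuple t).
Proof.
apply/rowP => j; rewrite [LHS]mxE; case: (split_ordP (j : 'I_(1 + n))) => i ->.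
  apply: etrans (esym (row_mxEl _ _ _ _)).
  by rewrite ord1 !mxE eqxx mulr1n (_ : lshift n 0 = ord0) ?tnth0//; exact/val_inj.
apply: etrans (esym (row_mxEr _ _ _ _)); rewrite mxE.
by rewrite (_ : rshift 1 i = lift ord0 i) ?tnthS//; exact/val_inj.
Qed.

Let tuple_prod n (S : set 'rV[R]_n.+1) :
    set (measurableTypeR R * n.-tuple (measurableTypeR R)) :=
  @tuple_cons _ (measurableTypeR R) n @^-1` (@row_of_tuple n.+1 @^-1` S).

Let measurable_tuple_prod n (S : set 'rV[R]_n.+1) :
  row_measurable S -> measurable (tuple_prod S).
Proof.
by move=> mS; rewrite -[X in measurable X]setTI; exact: measurable_tuple_cons.
Qed.

Let xsection_tuple_prod n (S : set 'rV[R]_n.+1) x :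
  xsection (tuple_prod S) x = @row_of_tuple n @^-1` [set v | S (row_cons x v)].
Proof.
apply/seteqP; split => t; rewrite /xsection/= inE /tuple_prod/= /tuple_cons/=;
  by rewrite row_of_tuple_cons.
Qed.

Let ysection_tuple_prod n (S : set 'rV[R]_n.+1) t :
  ysection (tuple_prod S) t = [set x | S (row_cons x (row_of_tuple t))].
Proof.
apply/seteqP; split => x; rewrite /ysection/= inE /tuple_prod/= /tuple_cons/=;
  by rewrite row_of_tuple_cons.
Qed.

Lemma row_measurable_tail n (S : set 'rV[R]_n.+1) x :
  row_measurable S -> row_measurable [set v : 'rV_n | S (row_cons x v)].
Proof.
move=> mS; rewrite /row_measurable -xsection_tuple_prod.
by apply: measurable_xsection; exact: measurable_tuple_prod.
Qed.

Lemma row_measurable_head n (S : set 'rV[R]_n.+1) (t : n.-tuple R) :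
  row_measurable S ->
  measurable ([set x | S (row_cons x (row_of_tuple t))] : set (measurableTypeR R)).
Proof.
move=> mS; rewrite -ysection_tuple_prod.
by apply: measurable_ysection; exact: measurable_tuple_prod.
Qed.

Lemma volume_int_tail n (S : set 'rV[R]_n.+1) :
  volume S = (\int[mu]_x volume [set v : 'rV_n | S (row_cons x v)])%E.
Proof.
rewrite /volume/= /tuple_cons_measure /pushforward /product_measure1.
by apply: eq_integral => x _ /=; rewrite -xsection_tuple_prod.
Qed.

(** Tonelli: the iterated integrals in the two orders are measures that agree on rectangles.
    Together with [volume_int_tail] this lets a linear map be studied on slices of either kind. *)
Lemma volume_int_head n (S : set 'rV[R]_n.+1) : row_measurable S ->
  volume S = (\int[lebesgue_measure_tuple R n]_t
                mu [set x | S (row_cons x (row_of_tuple t))])%E.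
Proof.
move=> mS; transitivity ((mu \x^ lebesgue_measure_tuple R n)%E (tuple_prod S)).
  apply: product_measure_unique; last exact: measurable_tuple_prod.
  by move=> A B mA mB /=; rewrite product_measure2E.
by apply: eq_integral => t _ /=; rewrite -ysection_tuple_prod.
Qed.

Let measurable_volume_tail n (S : set 'rV[R]_n.+1) : row_measurable S ->
  measurable_fun setT (fun x : measurableTypeR R => volume [set v : 'rV_n | S (row_cons x v)]).
Proof.
move=> mS.
have := measurable_fun_xsection (lebesgue_measure_tuple R n) (measurable_tuple_prod mS).
by apply: eq_measurable_fun => x _ /=; rewrite xsection_tuple_prod.
Qed.

Let measurable_measure_head n (S : set 'rV[R]_n.+1) : row_measurable S ->
  measurable_fun setT (fun t : n.-tuple (measurableTypeR R) =>
    mu [set x | S (row_cons x (row_of_tuple t))]).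
Proof.
move=> mS.
have := measurable_fun_ysection mu (measurable_tuple_prod mS).
by apply: eq_measurable_fun => t _ /=; rewrite ysection_tuple_prod.
Qed.

Let scales_volume n (A : 'M[R]_n) (p : 'rV[R]_n) :=
  forall S, row_measurable S ->
  volume [set v | S (v *m A + p)] = (`|\det A|^-1%:E * volume S)%E.

Let scales_volumeM n (A B : 'M[R]_n) p q :
  scales_volume A p -> scales_volume B q -> scales_volume (A *m B) (p *m B + q).
Proof.
move=> hA hB S mS; rewrite det_mulmx normrM invfM EFinM -muleA -hB// -hA.
  by congr (volume _); apply/seteqP; split => v /=; rewrite mulmxA addrA mulmxDl.
exact: row_measurable_affine.
Qed.

(** The slice with head [x] undergoes [A] with translation [x *: w + p]; this is why [A] is assumed
    to scale volume for every translation. *)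
Let scales_volume_tail n (w : 'rV[R]_n) (A : 'M[R]_n) (p : 'rV[R]_n) :
  (forall p, scales_volume A p) ->
  @scales_volume (1 + n) (block_mx 1%:M w 0 A) (row_mx 0 p).
Proof.
move=> hA S mS; rewrite det_ublock det1 mul1r !volume_int_tail.
rewrite -ge0_integralZl_EFin//; last exact: measurable_volume_tail.
apply: eq_integral => x _; rewrite -(hA (x *: w + p)); last exact: row_measurable_tail.
congr (volume _); apply/seteqP; split => v /=;
rewrite /row_cons mul_row_block add_row_mx mulmx1 mulmx0 !addr0 mul_scalar_mx;
by rewrite addrCA addrA.
Qed.

(** Each slice with fixed tail undergoes a one-dimensional affine map of slope [a]; the tail enters
    only through the shift. *)
Let scales_volume_head n (a : R) (c : 'cV[R]_n) (p : R) : a != 0 ->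
  @scales_volume (1 + n) (block_mx a%:M 0 c 1%:M) (row_mx p%:M 0).
Proof.
move=> a0 S mS; rewrite det_lblock det1 mulr1 det_scalar1.
rewrite !volume_int_head//; last exact: row_measurable_affine.
rewrite -ge0_integralZl_EFin//; last exact: measurable_measure_head.
apply: eq_integral => t _.
have := mx11_scalar (row_of_tuple t *m c).
set k := (row_of_tuple t *m c) 0 0 => kE.
rewrite -(lebesgue_measure_affine (k + p))//; last exact: row_measurable_head.
congr (mu _); apply/seteqP; split => x /=;
rewrite /row_cons mul_row_block add_row_mx mulmx1 mulmx0 add0r addr0 -scalar_mxM;
by rewrite kE -!raddfD/= addrA.
Qed.

(** Gaussian elimination by blocks: if the corner entry is nonzero, the map is one that changes only
    the head followed by one that fixes the head, and the lower block of the latter falls to the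
    induction hypothesis. *)
Lemma volume_affine n (A : 'M[R]_n) (p : 'rV[R]_n) (S : set 'rV[R]_n) :
  A \in unitmx -> row_measurable S ->
  volume [set v | S (v *m A + p)] = (`|\det A|^-1%:E * volume S)%E.
Proof.
move=> uA; elim: n A p uA S => [|n IH] A p uA.
  move=> S mS; rewrite det_mx00 normr1 invr1 mul1e.
  by congr (volume _); apply/seteqP; split => v /=; rewrite [_ + _]thinmx0 [v]thinmx0.
have corner (B : 'M[R]_(1 + n)) q : B 0 0 != 0 -> B \in unitmx -> scales_volume B q.
  move=> B00 uB; pose a := B 0 0.
  pose w : 'rV_n := a^-1 *: ursubmx B.
  (* The Schur complement of the corner. *)
  pose B' : 'M[R]_n := drsubmx B - dlsubmx B *m w.
  have ulE : ulsubmx B = a%:M.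
    by rewrite [LHS]mx11_scalar !mxE; congr (_%:M); congr (B _ _); exact/val_inj.
  have BE : B = block_mx a%:M 0 (dlsubmx B) 1%:M *m block_mx 1%:M w 0 B'.
    rewrite mulmx_block !mul0mx !mulmx0 !mulmx1 !mul1mx !addr0 mul_scalar_mx.
    by rewrite scalerA divff// scale1r addrCA subrr addr0 -ulE submxK.
  have uB' : B' \in unitmx.
    move: uB; rewrite BE unitmx_mul => /andP[_].
    by rewrite !unitmxE det_ublock det1 mul1r.
  pose b := lsubmx q 0 0.
  have -> : q = row_mx b%:M (0 : 'rV_n) *m block_mx 1%:M w 0 B' +
                row_mx 0 (rsubmx q - b *: w).
    rewrite mul_row_block add_row_mx mulmx1 mul0mx mul0mx !addr0 mul_scalar_mx.
    by rewrite addrCA subrr addr0 /b -mx11_scalar hsubmxK.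
  rewrite BE; apply: scales_volumeM; first exact: scales_volume_head.
  by apply: scales_volume_tail => r S; exact: IH.
have e0 : @lshift 1 n 0 = 0 :> 'I_n.+1 by exact/val_inj.
have [A00|] := eqVneq (A 0 0) 0; last by move=> A00; exact: corner.
(* A multiple of the remaining rows is added to the first one to get a nonzero pivot. *)
pose c : 'cV_n := dlsubmx (A : 'M[R]_(1 + n)).
pose B : 'M[R]_(1 + n) := block_mx 1%:M c^T 0 1%:M *m A.
have AE : A = block_mx 1%:M (- c^T) 0 1%:M *m B.
  rewrite /B mulmxA mulmx_block !mul0mx !mulmx0 !mulmx1 !mul1mx !addr0 add0r subrr.
  by rewrite -scalar_mx_block mul1mx.
have uB : B \in unitmx.
  by move: uA; rewrite AE unitmx_mul => /andP[].
have c0 : c != 0.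
  apply: contraTneq uA => c0; rewrite unitmxE unitfE negbK.
  rewrite (_ : A = block_mx (ulsubmx (A : 'M[R]_(1 + n))) (ursubmx (A : 'M[R]_(1 + n))) 0
    (drsubmx (A : 'M[R]_(1 + n)))); last by rewrite -c0 submxK.
  rewrite -[X in X == 0]/(@determinant R (1 + n) (block_mx _ _ _ _)) det_ublock.
  rewrite [ulsubmx _]mx11_scalar det_scalar1 !mxE.
  by rewrite e0 A00 mul0r.
rewrite AE -[p]add0r -(mul0mx _ B); apply: scales_volumeM.
  rewrite -[X in scales_volume _ X](@row_mx0 _ 1 1 n).
  apply: scales_volume_tail => r S; apply: IH; exact: unitmx1.
apply: corner => //.
(* The coefficients added are the entries of the first column below the corner, so the new pivot is
   the sum of their squares. *)
have -> : B 0 0 = ulsubmx B 0 0 by rewrite [RHS]mxE [RHS]mxE e0.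
have -> : ulsubmx B = ulsubmx (A : 'M[R]_(1 + n)) + c^T *m c.
  by rewrite /B -[X in ulsubmx (_ *m X)](@submxK _ 1 n 1 n A) mulmx_block block_mxKul mul1mx.
rewrite !mxE e0 A00 add0r.
rewrite psumr_neq0 => [|i _]; last by rewrite mxE -expr2 sqr_ge0.
have /rV0Pn[i ci] : c^T != 0 by rewrite trmx_eq0.
apply/hasP; exists i; first by rewrite mem_index_enum.
move: ci; rewrite [c^T _ _]mxE => ci.
have : 0 < c i 0 ^+ 2 by rewrite exprn_even_gt0.
by rewrite expr2.
Qed.

End volume.

(** * Convex hulls and simplices *)

Section convex_hull.
Context {R : realType}.

Lemma convex_combination (V : lmodType R) (C : set V) m (y : 'I_m.+1 -> V)
    (c : 'I_m.+1 -> R) :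
  convex_set C -> (forall i, C (y i)) -> (forall i, 0 <= c i) ->
  \sum_i c i = 1 -> C (\sum_i c i *: y i).
Proof.
move=> cC; elim: m y c => [|m IH] y c Cy c0 c1.
  by rewrite big_ord1; move: c1; rewrite big_ord1 => ->; rewrite scale1r.
pose a := c ord0; pose b := \sum_(i < m.+1) c (lift ord0 i).
have ab : a + b = 1 by rewrite -c1 big_ord_recl.
rewrite big_ord_recl -/a.
have b0 : 0 <= b by exact: sumr_ge0.
have [b00|bN0] := eqVneq b 0.
  rewrite big1 => [|i _].
    by rewrite addr0 -[a]addr0 -b00 ab scale1r.
  have := b00; move/eqP; rewrite psumr_eq0// => /allP/(_ i (mem_index_enum _)).
  by move=> /implyP/(_ isT)/eqP ->; rewrite scale0r.
have a01 : a <= 1 by rewrite -ab lerDl.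
have -> : \sum_(i < m.+1) c (lift ord0 i) *: y (lift ord0 i) =
    (1 - a) *: \sum_(i < m.+1) (c (lift ord0 i) / b) *: y (lift ord0 i).
  rewrite scaler_sumr; apply: eq_bigr => i _; rewrite scalerA; congr (_ *: _).
  by rewrite -ab addrC addKr mulrCA divff// mulr1.
have := cC (y ord0) (\sum_(i < m.+1) (c (lift ord0 i) / b) *: y (lift ord0 i))
  (Itv01 (c0 ord0) a01).
rewrite !inE; apply=> //; apply: IH => //.
  by move=> i; rewrite divr_ge0.
by rewrite -mulr_suml divff.
Qed.

Lemma convex_hull_range (V : lmodType R) m (y : 'I_m.+1 -> V) :
  convex_hull (range y) = [set v | exists c : 'I_m.+1 -> R,
    [/\ forall i, 0 <= c i, \sum_i c i = 1 & v = \sum_i c i *: y i]].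
Proof.
apply/seteqP; split.
  apply: smallest_sub.
    move=> v w l; rewrite !inE => -[c [c0 c1 ->]] [e [e0 e1 ->]].
    have l0 : 0 <= l%:num by [].
    have l1 : 0 <= 1 - l%:num by rewrite subr_ge0.
    exists (fun i => l%:num * c i + (1 - l%:num) * e i); split.
    - by move=> i; rewrite addr_ge0// mulr_ge0.
    - by rewrite big_split/= -!mulr_sumr c1 e1 !mulr1 addrC subrK.
    transitivity (l%:num *: (\sum_i c i *: y i) +
      (1 - l%:num) *: (\sum_i e i *: y i)) => //.
    rewrite !scaler_sumr -big_split/=.
    by apply: eq_bigr => i _; rewrite [RHS]scalerDl !scalerA.
  move=> _ [i _ <-]; exists (fun j => (j == i)%:R); split.
  - by move=> j; rewrite ler0n.
  - by rewrite (bigD1 i)//= eqxx big1 ?addr0// => j /negbTE ->.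
  rewrite (bigD1 i)//= eqxx scale1r big1 ?addr0// => j ji.
  by rewrite (negbTE ji) scale0r.
move=> v [c [c0 c1 ->]] C [cC yC]; apply: convex_combination => // i.
by apply: yC; exists i.
Qed.

(** [facet] removes the point [x i] from the range; injectivity turns this into dropping the index
    [i]. *)
Lemma facet_range d (x : 'I_d.+1 -> 'rV[R]_d) i : injective x ->
  facet x i = convex_hull (range (fun j => x (lift i j))).
Proof.
move=> xI; rewrite /facet; congr convex_hull; apply/seteqP; split.
  move=> _ [[j _ <-]] /= ji; case: (unliftP i j) => [k jk|ji'].
    by exists k => //; rewrite jk.
  by case: ji; rewrite ji'.
move=> _ [j _ <-]; split; first by exists (lift i j).
by move=> /xI/esym/eqP; rewrite eq_liftF.
Qed.

End convex_hull.

(** * The standard simplex and volumes of full-dimensional simplices *)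

Section standard_simplex.
Context {R : realType}.

Definition std_simplex k : set 'rV[R]_k :=
  [set v | (forall j, 0 <= v 0 j) /\ \sum_j v 0 j <= 1].
Arguments std_simplex : clear implicits.

Lemma row_measurable_itv k (I : 'I_k -> interval R) :
  row_measurable [set v : 'rV[R]_k | forall j, v 0 j \in I j].
Proof.
rewrite /row_measurable (_ : _ @^-1` _ =
    \bigcap_(j in [set: 'I_k]) ((fun t : k.-tuple (measurableTypeR R) =>
      row_of_tuple t 0 j : measurableTypeR R) @^-1` [set` I j])); last first.
  by apply/seteqP; split => t /= tI j => [_|]; exact: tI.
apply: fin_bigcap_measurable => // j _.
by rewrite -[X in measurable X]setTI; apply: measurable_row_coord.
Qed.

Lemma row_measurable_std_simplex k : row_measurable (std_simplex k).
Proof.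
rewrite /row_measurable (_ : _ @^-1` _ =
    (@row_of_tuple R k @^-1` [set v | forall j, v 0 j \in `[0, +oo[%R]) `&`
    ((fun t : k.-tuple (measurableTypeR R) =>
      \sum_j row_of_tuple t 0 j : measurableTypeR R) @^-1` `]-oo, 1]%classic)); last first.
  apply/seteqP; split => t /=.
    by move=> [t0 t1]; split => [j|]; rewrite in_itv/= ?andbT.
  by move=> [t0]; rewrite in_itv/= => t1; split=> // j; have := t0 j; rewrite in_itv/= andbT.
apply: measurableI; first exact: row_measurable_itv.
rewrite -[X in measurable X]setTI; apply: measurable_sum => // j.
exact: measurable_row_coord.
Qed.

Lemma volume_cube k (b : R) : 0 <= b ->
  volume [set v : 'rV[R]_k | forall j, v 0 j \in `[0, b]] = (b ^+ k)%:E.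
Proof.
move=> b0; elim: k => [|k IH].
  rewrite /volume/= diracE mem_set// => -[//].
rewrite /volume/= /tuple_cons_measure /pushforward.
rewrite (_ : _ @^-1` _ = `[0, b]%classic `*`
  (@row_of_tuple R k @^-1` [set v | forall j, v 0 j \in `[0, b]])); last first.
  apply/seteqP; split=> -[x t] /=.
    move=> h; split; first by have := h ord0; rewrite mxE/= tnth0.
    by move=> j; have := h (lift ord0 j); rewrite !mxE/= tnthS.
  move=> [/= hx ht] j; rewrite mxE; case: (unliftP ord0 j) => [i ->|->].
    by rewrite tnthS; have := ht i; rewrite mxE.
  by rewrite tnth0.
rewrite product_measure1E//; last exact: row_measurable_itv.
have mb : lebesgue_measure (`[0, b]%classic : set R) = b%:E.
  rewrite lebesgue_measure_itv/= lte_fin oppr0 adde0.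
  by case: ltgtP b0 => // <-.
by rewrite [X in (_ * X)%E]IH [X in (X * _)%E]mb -EFinM -exprS.
Qed.

Lemma le_volume k (S T : set 'rV[R]_k) : row_measurable S -> row_measurable T ->
  S `<=` T -> (volume S <= volume T)%E.
Proof. by move=> mS mT ST; apply: le_measure; rewrite ?inE// => t /ST. Qed.

Definition std_volume k : R := fine (volume (std_simplex k)).

(** The simplex contains the cube of side 1/(k+1) and is contained in the unit cube. *)
Lemma volume_std_simplex k : volume (std_simplex k) = (std_volume k)%:E /\ 0 < std_volume k.
Proof.
have lo : ((k.+1%:R^-1 ^+ k)%:E <= volume (std_simplex k))%E.
  rewrite -(@volume_cube k) ?invr_ge0//; apply: le_volume.
  - exact: row_measurable_itv.
  - exact: row_measurable_std_simplex.
  move=> v /= h; split=> [j|]; first by have := h j; rewrite in_itv => /andP[].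
  apply: (@le_trans _ _ (\sum_(j < k) k.+1%:R^-1)).
    by apply: ler_sum => j _; have := h j; rewrite in_itv => /andP[].
  rewrite sumr_const card_ord -[X in X <= _]mulr_natl ler_pdivrMr ?ltr0n//.
  by rewrite mul1r ler_nat.
have hi : (volume (std_simplex k) <= 1)%E.
  rewrite -(expr1n R k) -(@volume_cube k)//; apply: le_volume.
  - exact: row_measurable_std_simplex.
  - exact: row_measurable_itv.
  move=> v [v0 v1] j; rewrite in_itv/= v0/= (le_trans _ v1)//.
  by rewrite (bigD1 j)//= lerDl sumr_ge0.
have fin : volume (std_simplex k) \is a fin_num.
  rewrite ge0_fin_numE; last exact: measure_ge0.
  by rewrite (le_lt_trans hi)// ltry.
rewrite /std_volume fineK//; split=> //.
rewrite -lte_fin fineK//; apply: lt_le_trans lo.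
by rewrite lte_fin exprn_gt0// invr_gt0 ltr0n.
Qed.

Definition edge_mx k n (y : 'I_k.+1 -> 'rV[R]_n) : 'M[R]_(k, n) :=
  \matrix_(j < k) (y (lift ord0 j) - y ord0).

(** The barycentric coefficient of [y ord0] is one minus the others, so the others range over the
    standard simplex. *)
Lemma convex_hull_edge_mx k n (y : 'I_k.+1 -> 'rV[R]_n) :
  convex_hull (range y) = [set y ord0 + w *m edge_mx y | w in std_simplex k].
Proof.
have E (w : 'rV_k) : w *m edge_mx y =
    \sum_j w 0 j *: y (lift ord0 j) - (\sum_j w 0 j) *: y ord0.
  rewrite mulmx_sum_row scaler_suml -sumrB; apply: eq_bigr => j _.
  by rewrite rowK scalerBr.
rewrite convex_hull_range; apply/seteqP; split => v /=.
  move=> [c [c0 c1 ->]]; move: c1; rewrite !big_ord_recl => c1.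
  exists (\row_j c (lift ord0 j)).
    split=> [j|]; first by rewrite mxE.
    by under eq_bigr do rewrite mxE; rewrite -c1 lerDr.
  rewrite E; under eq_bigr do rewrite mxE.
  under [X in _ - X *: _]eq_bigr do rewrite mxE.
  rewrite addrCA addrC; congr (_ + _).
  by rewrite -{1}[y ord0]scale1r -scalerBl -c1 addrK.
move=> [w [w0 w1] <-].
exists (fun i => if unlift ord0 i is Some j then w 0 j else 1 - \sum_j w 0 j).
split.
- by move=> i; case: unliftP => [j _|_]//; rewrite subr_ge0.
- rewrite big_ord_recl unlift_none.
  by under [X in _ + X]eq_bigr do rewrite liftK; rewrite subrK.
rewrite big_ord_recl unlift_none; under [X in _ = _ + X]eq_bigr do rewrite liftK.
by rewrite E scalerBl scale1r addrCA addrC.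
Qed.

Lemma volume_simplex k (u : 'I_k.+1 -> 'rV[R]_k) : edge_mx u \in unitmx ->
  volume (convex_hull (range u)) = (`|\det (edge_mx u)| * std_volume k)%:E.
Proof.
move=> uM; set M := edge_mx u in uM *.
have -> : convex_hull (range u) =
    [set v | std_simplex k (v *m invmx M + - (u ord0 *m invmx M))].
  rewrite convex_hull_edge_mx -/M; apply/seteqP; split => v /=.
    move=> [w sw <-]; rewrite mulmxDl addrC addKr -mulmxA mulmxV//.
    by rewrite mulmx1.
  move=> sv; exists (v *m invmx M - u ord0 *m invmx M) => //.
  by rewrite -mulmxBl -mulmxA mulVmx// mulmx1 addrC subrK.
rewrite volume_affine ?unitmx_inv//; last exact: row_measurable_std_simplex.
by rewrite (volume_std_simplex k).1 -EFinM det_inv normfV invrK.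
Qed.

End standard_simplex.
Arguments std_simplex {R} k.
Arguments std_volume {R} k.

(** * Facet volumes *)

Section flat_volume.
Context {R : realType}.

Definition normrv n (u : 'rV[R]_n) : R := Num.sqrt (dotrv u u).

Lemma dotrvE n (u v : 'rV[R]_n) : dotrv u v = (u *m v^T) 0 0.
Proof. by rewrite mxE; apply: eq_bigr => i _; rewrite mxE. Qed.

Lemma dotrvC n (u v : 'rV[R]_n) : dotrv u v = dotrv v u.
Proof. by apply: eq_bigr => i _; rewrite mulrC. Qed.

Lemma mulmx_trE n (u v : 'rV[R]_n) : u *m v^T = (dotrv u v)%:M.
Proof. by rewrite dotrvE -mx11_scalar. Qed.

Lemma dotrvDl n (u v w : 'rV[R]_n) : dotrv (u + v) w = dotrv u w + dotrv v w.
Proof. by rewrite !dotrvE mulmxDl mxE. Qed.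

Lemma dotrvZl n a (u w : 'rV[R]_n) : dotrv (a *: u) w = a * dotrv u w.
Proof. by rewrite !dotrvE -scalemxAl mxE. Qed.

Lemma dotrvBl n (u v w : 'rV[R]_n) : dotrv (u - v) w = dotrv u w - dotrv v w.
Proof. by rewrite dotrvDl -scaleN1r dotrvZl mulN1r. Qed.

Lemma dotrvZr n a (u w : 'rV[R]_n) : dotrv u (a *: w) = a * dotrv u w.
Proof. by rewrite dotrvC dotrvZl dotrvC. Qed.

Lemma dotrvDr n (u v w : 'rV[R]_n) : dotrv w (u + v) = dotrv w u + dotrv w v.
Proof. by rewrite dotrvC dotrvDl !(dotrvC w). Qed.

Lemma dotrv_ge0 n (u : 'rV[R]_n) : 0 <= dotrv u u.
Proof. by apply: sumr_ge0 => i _; rewrite -expr2 sqr_ge0. Qed.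

Lemma dotrv_eq0 n (u : 'rV[R]_n) : (dotrv u u == 0) = (u == 0).
Proof.
apply/idP/eqP => [|->]; last by rewrite dotrvE mul0mx mxE.
rewrite psumr_eq0 => [/allP u0|i _]; last by rewrite -expr2 sqr_ge0.
apply/rowP => i; rewrite mxE; have := u0 i (mem_index_enum _).
by rewrite mulf_eq0 orbb => /eqP.
Qed.

Lemma sqr_normrv n (u : 'rV[R]_n) : normrv u ^+ 2 = dotrv u u.
Proof. by rewrite sqr_sqrtr// dotrv_ge0. Qed.

Lemma normrv_gt0 n (u : 'rV[R]_n) : (0 < normrv u) = (u != 0).
Proof. by rewrite sqrtr_gt0 lt_neqAle dotrv_ge0 andbT eq_sym dotrv_eq0. Qed.

Lemma normrvZ n a (u : 'rV[R]_n) : normrv (a *: u) = `|a| * normrv u.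
Proof.
by rewrite /normrv dotrvZl dotrvZr mulrA -expr2 sqrtrM ?sqr_ge0// sqrtr_sqr.
Qed.

(* Householder reflection exchanging [g] and the first basis vector. *)
Lemma orthogonal_completion n (g : 'rV[R]_(1 + n)) : dotrv g g = 1 ->
  exists2 H : 'M[R]_(1 + n), H *m H^T = 1%:M & usubmx H = g.
Proof.
move=> g1; pose e : 'rV[R]_(1 + n) := row_mx 1%:M 0.
have eH (H : 'M[R]_(1 + n)) : usubmx H = e *m H.
  by rewrite -[in RHS](vsubmxK H) mul_row_col mul1mx mul0mx addr0.
have [ge|gNe] := eqVneq g e.
  by exists 1%:M; rewrite ?trmx1 ?mulmx1// eH mulmx1.
pose w := g - e; pose s := dotrv w w.
have s0 : s != 0 by rewrite dotrv_eq0 subr_eq0.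
have ee : dotrv e e = 1.
  by rewrite dotrvE tr_row_mx mul_row_col trmx1 mul1mx trmx0 mul0mx addr0 mxE.
have ew : dotrv e w = - (s / 2).
  rewrite /s /w dotrvBl (dotrvC e) (dotrvC g) !dotrvBl ee g1 (dotrvC e g).
  by field.
pose H := 1%:M - (2 / s) *: (w^T *m w).
have HT : H^T = H.
  by rewrite /H raddfB/= trmx1 linearZ/= trmx_mul trmxK.
exists H.
  (* The rank-one matrix [w^T *m w] is [s] times a projection, which makes the symmetric matrix [H]
     an involution. *)
  have ww : w^T *m w *m (w^T *m w) = s *: (w^T *m w).
    by rewrite mulmxA -(mulmxA w^T) mulmx_trE -/s mul_mx_scalar -scalemxAl.
  rewrite HT /H; move: (w^T *m w) ww => P PP.
  rewrite mulmxBl mul1mx mulmxBr mulmx1 -scalemxAl -scalemxAr PP.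
  apply/matrixP => i j; rewrite !mxE.
  by field.
rewrite eH /H mulmxBr mulmx1 -scalemxAr mulmxA mulmx_trE ew mul_scalar_mx.
rewrite scalerA (_ : 2 / s * - (s / 2) = -1); last by field.
by rewrite scaleN1r opprK /w addrC subrK.
Qed.

(** In every chart the squared determinant of the edges is their Gram determinant, so the infimum in
    [flat_volume] is over a single value. The second hypothesis says that the edges lie in the row
    space of [Q]. *)
Lemma flat_volume_simplex k n (y : 'I_k.+1 -> 'rV[R]_n) (Q : 'M[R]_(k, n)) :
  Q *m Q^T = 1%:M -> edge_mx y *m Q^T *m Q = edge_mx y ->
  edge_mx y *m Q^T \in unitmx ->
  flat_volume k (convex_hull (range y)) =
    (`|\det (edge_mx y *m Q^T)| * std_volume k)%:E.
Proof.
move=> QQ yQ uE; set E := edge_mx y in yQ uE *.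
have detE : \det (E *m E^T) = \det (E *m Q^T) ^+ 2.
  rewrite -[E in E^T]yQ trmx_mul mulmxA det_mulmx expr2; congr (_ * _).
  by rewrite det_tr.
have key p (P : 'M[R]_(k, n)) : P *m P^T = 1%:M ->
    convex_hull (range y) `<=` range (fun u => p + u *m P) ->
    volume [set u | convex_hull (range y) (p + u *m P)] =
    (`|\det (E *m Q^T)| * std_volume k)%:E.
  move=> PP yP.
  have /choice[u uE'] : forall j, exists u : 'rV_k, p + u *m P = y j.
    move=> j; have [|u _ uj] := yP (y j); last by exists u.
    by apply: sub_gen_smallest; exists j.
  have EP : E = edge_mx u *m P.
    apply/row_matrixP => j; rewrite row_mul !rowK mulmxBl -!uE'.
    by rewrite opprD addrACA subrr add0r.
  have d2 : \det (edge_mx u) ^+ 2 = \det (E *m Q^T) ^+ 2.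
    rewrite -detE EP trmx_mul mulmxA -(mulmxA (edge_mx u)) PP mulmx1.
    by rewrite det_mulmx det_tr expr2.
  have dE : `|\det (edge_mx u)| = `|\det (E *m Q^T)|.
    by apply/eqP; rewrite -(@eqrXn2 _ 2)// !real_normK ?num_real// d2.
  rewrite -dE -volume_simplex; last first.
    by move: uE; rewrite !unitmxE !unitfE -!normr_gt0 dE.
  congr (volume _); rewrite !convex_hull_edge_mx -/E; apply/seteqP; split => v /=.
    move=> [w sw vE]; exists w => //.
    have := congr1 (fun z => (z - p) *m P^T) vE.
    rewrite /= -uE' EP -[p + _ + _]addrA !(addrC p) !addrK mulmxA -mulmxDl.
    by rewrite -!mulmxA PP !mulmx1.
  move=> [w sw <-]; exists w => //.
  by rewrite -uE' EP mulmxDl mulmxA addrA.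
rewrite /flat_volume [X in ereal_inf X](_ : _ =
    [set (`|\det (E *m Q^T)| * std_volume k)%:E]) ?ereal_inf1//.
apply/seteqP; split => v /=.
  by move=> [p [P [PP yP ->]]]; exact: key.
have yP : convex_hull (range y) `<=` range (fun u => y ord0 + u *m Q).
  move=> z; rewrite convex_hull_edge_mx => -[w _ <-].
  by exists (w *m (E *m Q^T)) => //; rewrite -mulmxA yQ.
by move=> ->; exists (y ord0), Q; split=> //; rewrite -(key _ _ QQ yP).
Qed.

End flat_volume.

(** * Determinants of simplices, and base times height *)

Section simplex.
Context {R : realType}.

Lemma matrix_rowsE n m (f : 'I_n.+1 -> 'rV[R]_m) :
  \matrix_j f j = col_mx (f ord0) (\matrix_(j < n) f (lift ord0 j)) :> 'M[R]_(1 + n, m).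
Proof.
apply/matrixP => j l; rewrite [LHS]mxE; case: (split_ordP j) => i ->.
  by rewrite col_mxEu ord1; congr (f _ _ _); exact/val_inj.
by rewrite col_mxEd mxE; congr (f _ _ _); exact/val_inj.
Qed.

(** The vertices in homogeneous coordinates: the inverse of this matrix contains the coefficients of
    the barycentric coordinates, constant terms in its first row and gradients below. *)
Definition simplex_mx d (x : 'I_d.+1 -> 'rV[R]_d) : 'M[R]_(1 + d) :=
  row_mx (const_mx 1) (\matrix_j x j : 'M[R]_(d.+1, d)).

Lemma mul_simplex_mx d (x : 'I_d.+1 -> 'rV[R]_d) (v : 'rV[R]_d.+1) :
  v *m simplex_mx x = row_mx (\sum_i v 0 i)%:M (\sum_i v 0 i *: x i).
Proof.
rewrite mul_mx_row; congr row_mx.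
  apply/rowP => j; rewrite ord1 !mxE eqxx mulr1n.
  by apply: eq_bigr => i _; rewrite mxE mulr1.
by rewrite mulmx_sum_row; apply: eq_bigr => i _; rewrite rowK.
Qed.

Lemma affinely_independent_unitmx d (x : 'I_d.+1 -> 'rV[R]_d) :
  affinely_independent x <-> simplex_mx x \in unitmx.
Proof.
rewrite -row_free_unit; split=> [xI|xU c c0 cx].
  apply/inj_row_free => v; rewrite mul_simplex_mx -[X in _ = X -> _]row_mx0 => /eq_row_mx[s0 sx].
  have s0' : \sum_i v 0 i = 0.
    by move/matrixP: s0 => /(_ 0 0); rewrite !mxE eqxx mulr1n.
  apply/rowP => i; rewrite mxE; exact: (xI (v 0) s0' sx i).
have := mul_simplex_mx x (\row_i c i).
under eq_bigr do rewrite mxE.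
under [X in row_mx _ X]eq_bigr do rewrite mxE.
rewrite c0 cx -scalemx1 scale0r row_mx0 => /eqP.
rewrite -(mul0mx _ (simplex_mx x)) => /eqP/(row_free_inj xU)/rowP ce i.
by have := ce i; rewrite !mxE.
Qed.

Lemma det_simplex_mx d (x : 'I_d.+1 -> 'rV[R]_d) :
  \det (simplex_mx x) = \det (edge_mx x).
Proof.
have -> : simplex_mx x =
    block_mx 1%:M 0 (const_mx 1) 1%:M *m block_mx 1%:M (x ord0) 0 (edge_mx x).
  rewrite mulmx_block !mul0mx !mulmx0 !mul1mx !mulmx1 !addr0.
  transitivity (block_mx 1%:M (x ord0) (const_mx 1)
      (\matrix_j x (lift ord0 j)) : 'M[R]_(1 + d)).
    rewrite block_mxEh /simplex_mx matrix_rowsE; congr row_mx.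
    apply/matrixP => i j; rewrite [LHS]mxE; case: (split_ordP i) => l ->.
      by rewrite col_mxEu !ord1 mxE.
    by rewrite col_mxEd mxE.
  congr block_mx.
  apply/row_matrixP => j; rewrite rowK raddfD/= rowK addrC row_mul.
  rewrite (_ : row j _ = 1%:M) ?mul1mx ?subrK//.
  by apply/rowP => i; rewrite !mxE ord1.
by rewrite det_mulmx det_lblock det_ublock !det1 !mul1r.
Qed.

Lemma det_differences k (y : 'I_k.+1 -> 'rV[R]_k.+1) (c : 'rV[R]_k.+1) :
  \det (\matrix_j (y j - c)) = \det (col_mx (y ord0 - c) (edge_mx y) : 'M[R]_(1 + k)).
Proof.
have E : \matrix_j (y j - c) = (block_mx 1%:M 0 (const_mx 1) 1%:M *m
    (col_mx (y ord0 - c) (edge_mx y)) : 'M[R]_(1 + k)).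
  rewrite matrix_rowsE mul_block_col mul1mx mul0mx addr0 mul1mx.
  rewrite (_ : _ *m _ + edge_mx y = \matrix_(j < k) (y (lift ord0 j) - c))//.
  apply/row_matrixP => j; rewrite raddfD/= !rowK row_mul.
  rewrite (_ : row j _ = 1%:M); last by apply/rowP => i; rewrite !mxE ord1.
  by rewrite mul1mx addrC addrA subrK.
rewrite -[LHS]/(@determinant R (1 + k) (\matrix_j (y j - c))) E.
by rewrite det_mulmx det_lblock !det1 !mul1r.
Qed.

(** Moving the vertex [i] to the front costs a sign, which the square absorbs; row operations then
    leave the edges of the opposite facet and one edge leading to it from [x i]. *)
Lemma sqr_det_simplex_mx_facet k (x : 'I_k.+2 -> 'rV[R]_k.+1) i :
  \det (simplex_mx x) ^+ 2 =
  \det (col_mx (x (@lift k.+2 i ord0) - x i) (edge_mx (x \o lift i)) : 'M[R]_(1 + k)) ^+ 2.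
Proof.
pose s := lift_perm ord0 i 1.
have -> : \det (simplex_mx x) ^+ 2 = \det (simplex_mx (x \o s)) ^+ 2.
  rewrite (_ : simplex_mx (x \o s) = row_perm s (simplex_mx x)).
    by rewrite row_permE det_mulmx det_perm exprMn sqrr_sign mul1r.
  by apply/matrixP => a b; rewrite !mxE; case: fintype.split => ?; rewrite !mxE.
congr (_ ^+ 2); rewrite det_simplex_mx -det_differences; congr (\det _).
apply/row_matrixP => j; rewrite !rowK /s/= lift_perm_id lift_perm_lift.
by rewrite perm1.
Qed.

(** The vector [g] is normal to the facet. Completing its direction [h] to an orthonormal basis
    gives a chart [Q] of the facet in which the simplex splits into base and height 1/|g|. *)
Theorem flat_volume_facet k (x : 'I_k.+2 -> 'rV[R]_k.+1) i (g : 'rV[R]_k.+1) :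
  affinely_independent x ->
  (forall a b, dotrv (x a - x b) g = (a == i)%:R - (b == i)%:R) ->
  flat_volume k (facet x i) =
    (`|\det (simplex_mx x)| * normrv g * std_volume k)%:E.
Proof.
move=> xI xg; have xU := (affinely_independent_unitmx x).1 xI.
have neq_lift' j : (lift i j == i) = false by rewrite eq_sym eq_liftF.
have g0 : 0 < normrv g.
  rewrite normrv_gt0; apply: contraTneq isT => g0.
  have := xg i (@lift k.+2 i ord0); rewrite g0 dotrvE trmx0 mulmx0 mxE eqxx neq_lift'.
  by move/eqP; rewrite subr0 eq_sym oner_eq0.
pose h := (normrv g)^-1 *: g : 'rV_(1 + k).
have hh : dotrv h h = 1.
  by rewrite dotrvZl dotrvZr -sqr_normrv; field; rewrite gt_eqF.
have [H HH Hh] := orthogonal_completion hh.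
pose Q := dsubmx H; pose y := x \o lift i.
have HE : H = col_mx h Q by rewrite -Hh vsubmxK.
have QQ : Q *m Q^T = 1%:M.
  move: HH; rewrite HE tr_col_mx mul_col_row [1%:M]scalar_mx_block.
  by move=> /eq_block_mx[].
have yh : edge_mx y *m h^T = 0.
  apply/row_matrixP => j; rewrite row_mul rowK row0 mulmx_trE dotrvZr xg.
  by rewrite !neq_lift' subr0 mulr0 -scalemx1 scale0r.
have yQ : edge_mx y *m Q^T *m Q = edge_mx y.
  rewrite -mulmxA (_ : Q^T *m Q = 1%:M - h^T *m h).
    by rewrite mulmxBr mulmx1 mulmxA yh mul0mx subr0.
  by rewrite -(mulmx1C HH) HE tr_col_mx mul_row_col addrC addKr.
(* Multiplying by [H^T] makes the matrix block triangular, since the facet edges are orthogonal to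
   [h]; the corner is the signed height -1/|g|. *)
have dE : \det (simplex_mx x) ^+ 2 = (\det (edge_mx y *m Q^T) / normrv g) ^+ 2.
  rewrite (sqr_det_simplex_mx_facet x i); set Z := col_mx _ _.
  have H2 : \det H ^+ 2 = 1 by rewrite expr2 -{2}det_tr -det_mulmx HH det1.
  rewrite -[LHS]mulr1 -H2 -(det_tr H) -exprMn -det_mulmx HE tr_col_mx mul_col_row.
  rewrite yh det_ublock mulmx_trE det_scalar1 dotrvZr xg eqxx neq_lift'.
  by rewrite sub0r mulrN1 !mulNr sqrrN mulrC.
have dE' : `|\det (edge_mx y *m Q^T)| = `|\det (simplex_mx x)| * normrv g.
  rewrite -[X in _ * X]gtr0_norm// -normrM; apply/eqP.
  rewrite -(@eqrXn2 _ 2)// !real_normK ?num_real// exprMn dE -exprMn.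
  by rewrite divfK // gt_eqF.
rewrite facet_range; last first.
  (* If [x a = x b] with [a] different from [b], the difference of the two indicators is an affine
     dependence. *)
  move=> a b ab; apply/eqP; apply: contraT => nab.
  have := xI (fun j => (j == a)%:R - (j == b)%:R).
  have S (f : 'I_k.+2 -> 'rV[R]_k.+1) c : \sum_j (j == c)%:R *: f j = f c.
    rewrite (bigD1 c)//= eqxx scale1r big1 ?addr0// => j /negbTE ->.
    by rewrite scale0r.
  have S1 c : \sum_(j < k.+2) (j == c)%:R = 1 :> R.
    by rewrite (bigD1 c)//= eqxx big1 ?addr0// => j /negbTE ->.
  rewrite sumrB !S1 subrr => /(_ erefl).
  under eq_bigr do rewrite scalerBl.
  rewrite sumrB !S ab subrr => /(_ erefl a)/eqP.
  by rewrite eqxx (negbTE nab) subr0 oner_eq0.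
rewrite -dE'; apply: flat_volume_simplex => //.
rewrite unitmxE unitfE -normr_gt0 dE' mulr_gt0// normr_gt0.
by rewrite -unitfE -unitmxE.
Qed.

End simplex.

(** * Closed polygons *)

Section polygon.
Context {R : realType}.

(** The second clause says that every linear relation is a multiple of the closing one. For
    [n = m + 1] the rank is then [m], so the vectors span. *)
Definition closed_spanning n m (g : 'I_n -> 'rV[R]_m) :=
  \sum_i g i = 0 /\
  forall z : 'I_n -> R, \sum_i z i *: g i = 0 -> forall i j, z i = z j.

Lemma dotrv_suml n m (u : 'I_n -> 'rV[R]_m) w :
  dotrv (\sum_i u i) w = \sum_i dotrv (u i) w.
Proof.
rewrite dotrvE mulmx_suml summxE; apply: eq_bigr => i _.
by rewrite dotrvE.
Qed.

(** The squared norm of |v| u + |u| v equals 2 |u| |v| (|u| |v| + u.v), and it is positive unless u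
    and v point in opposite directions. *)
Lemma cauchy_schwarz_lt n (u v : 'rV[R]_n) : u != 0 -> v != 0 ->
  normrv v *: u + normrv u *: v != 0 -> - (normrv u * normrv v) < dotrv u v.
Proof.
move=> u0 v0; set w := _ + _; rewrite -normrv_gt0 => w0.
have : 0 < normrv w ^+ 2 by rewrite exprn_gt0.
have uv : 0 < normrv u * normrv v by rewrite mulr_gt0// normrv_gt0.
rewrite sqr_normrv /w !(dotrvDl, dotrvDr, dotrvZl, dotrvZr) -!sqr_normrv (dotrvC v u).
set a := normrv u in uv *; set b := normrv v in uv *; set c := dotrv u v.
rewrite (_ : _ + _ = 2 * (a * b) * (a * b + c)); last by ring.
by rewrite pmulr_rgt0; [rewrite addrC -ltrBlDr sub0r | rewrite mulr_gt0].
Qed.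

(** Pairing the closing relation with [g i] bounds |g_i|^2 by Cauchy-Schwarz, strictly because no
    other side is opposite in direction to [g i]. *)
Lemma polygon_inequality n m (g : 'I_n -> 'rV[R]_m) i : (2 < n)%N ->
  closed_spanning g -> 0 < normrv (g i) /\ 2 * normrv (g i) < \sum_j normrv (g j).
Proof.
move=> n3 [g0 gK].
(* A relation supported on at most two indices has coefficient zero at a third one, hence is
   trivial. *)
have third (a b : 'I_n) : exists c, (c != a) && (c != b).
  apply/existsP; apply: contraTT n3; rewrite negb_exists => /forallP ab.
  rewrite -leqNgt -[n in (n <= _)%N]card_ord cardE.
  apply: (@leq_trans (size [:: a; b])) => //; apply: uniq_leq_size (enum_uniq _) _.
  by move=> c _; rewrite !inE; have := ab c; rewrite negb_and !negbK.
have sum_delta (c : R) a : \sum_j (if j == a then c else 0) *: g j = c *: g a.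
  rewrite (bigD1 a)//= eqxx big1 ?addr0// => j /negbTE ->.
  by rewrite scale0r.
have gN0 a : g a != 0.
  apply/eqP => ga0; have [b /andP[ba _]] := third a a.
  have := gK (fun j => if j == a then 1 else 0).
  rewrite sum_delta ga0 scaler0 => /(_ erefl a b)/eqP.
  by rewrite eqxx (negbTE ba) oner_eq0.
have i0 : 0 < normrv (g i) by rewrite normrv_gt0.
split=> //.
have cs j : j != i -> - (normrv (g j) * normrv (g i)) < dotrv (g j) (g i).
  move=> ji; apply: cauchy_schwarz_lt => //; apply/eqP => e.
  have [l /andP[lj li]] := third j i.
  have := gK (fun l => (if l == j then normrv (g i) else 0) +
                       (if l == i then normrv (g j) else 0)).
  under eq_bigr do rewrite scalerDl.
  rewrite big_split/= !sum_delta => /(_ e j l)/eqP.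
  by rewrite eqxx (negbTE ji) (negbTE lj) (negbTE li) !addr0 gt_eqF.
have sq : normrv (g i) * normrv (g i) = \sum_(j | j != i) - dotrv (g j) (g i).
  rewrite -expr2 sqr_normrv sumrN; apply/eqP; rewrite -addr_eq0 -(bigD1 i (P := predT))//=.
  by rewrite -dotrv_suml g0 dotrvE mul0mx mxE.
suff : normrv (g i) * normrv (g i) < (\sum_j normrv (g j) - normrv (g i)) * normrv (g i).
  by rewrite ltr_pM2r//; lra.
rewrite sq [\sum_j normrv (g j)](bigD1 i)//= [X in _ < X * _]addrC addKr mulr_suml.
apply: ltr_sum => [|j ji].
  have [b /andP[bi _]] := third i i.
  by apply/hasP; exists b; rewrite ?mem_index_enum.
by rewrite ltrNl cs.
Qed.

Definition fcons T n (x : T) (f : 'I_n -> T) (i : 'I_n.+1) : T :=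
  if unlift ord0 i is Some j then f j else x.

Lemma fcons0 T n (x : T) (f : 'I_n -> T) : fcons x f ord0 = x.
Proof. by rewrite /fcons unlift_none. Qed.

Lemma fconsS T n (x : T) (f : 'I_n -> T) j : fcons x f (lift ord0 j) = f j.
Proof. by rewrite /fcons liftK. Qed.

Lemma dotrv_row_mx n m (u u' : 'rV[R]_n) (v v' : 'rV[R]_m) :
  dotrv (row_mx u v) (row_mx u' v') = dotrv u u' + dotrv v v'.
Proof. by rewrite !dotrvE tr_row_mx mul_row_col mxE. Qed.

(** The triangle with base [c] and sides [p], [q]: [t] is its height, and the foot of the height
    divides the base in the ratio s : 1 - s. *)
Lemma triangle_apex (p q c : R) : 0 < p -> 0 < q -> `|p - q| < c -> c < p + q ->
  exists s t, [/\ t != 0, t ^+ 2 + s ^+ 2 * c ^+ 2 = p ^+ 2 &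
    t ^+ 2 + (1 - s) ^+ 2 * c ^+ 2 = q ^+ 2].
Proof.
move=> p0 q0 pqc cpq; have c0 : 0 < c by rewrite (le_lt_trans _ pqc).
move: pqc; rewrite ltr_norml => /andP[pqc1 pqc2].
(* Obtained by subtracting the two required equations. *)
pose s := (p ^+ 2 - q ^+ 2 + c ^+ 2) / (2 * c ^+ 2).
have sE : 2 * s * c ^+ 2 = p ^+ 2 - q ^+ 2 + c ^+ 2.
  by rewrite /s; field; rewrite gt_eqF.
have T0 : 0 < p ^+ 2 - s ^+ 2 * c ^+ 2.
  (* Heron's formula for the squared height. *)
  have -> : p ^+ 2 - s ^+ 2 * c ^+ 2 =
      ((p + c - q) * (p + c + q)) * ((q - p + c) * (q + p - c)) / (4 * c ^+ 2).
    by rewrite /s; field; rewrite gt_eqF.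
  by rewrite divr_gt0 ?mulr_gt0 ?exprn_gt0//; lra.
exists s, (Num.sqrt (p ^+ 2 - s ^+ 2 * c ^+ 2)).
rewrite gt_eqF ?sqrtr_gt0// sqr_sqrtr ?ltW//; split=> //; first by ring.
have -> : (1 - s) ^+ 2 * c ^+ 2 = s ^+ 2 * c ^+ 2 + c ^+ 2 - 2 * s * c ^+ 2 by ring.
by rewrite sE; ring.
Qed.

(* The side [h] of length [c] is replaced by two sides [(t, s h)] and
   [(-t, (1 - s) h)] with the same sum, using one new dimension. *)
Lemma closed_spanning_split d (a : 'I_d -> R) (c p q : R) (g : 'I_d.+1 -> 'rV[R]_d) :
  closed_spanning g -> (forall i, normrv (g i) = fcons c a i) ->
  0 < p -> 0 < q -> `|p - q| < c -> c < p + q ->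
  exists2 g' : 'I_d.+2 -> 'rV[R]_d.+1, closed_spanning g' &
    forall i, normrv (g' i) = fcons p (fcons q a) i.
Proof.
move=> [g0 gK] gn p0 q0 pqc cpq.
have [s [t [t0 tp tq]]] := triangle_apex p0 q0 pqc cpq.
pose h := g ord0.
have hc : dotrv h h = c ^+ 2 by rewrite -sqr_normrv gn fcons0.
pose g' : 'I_d.+2 -> 'rV[R]_(1 + d) := fcons (row_mx t%:M (s *: h))
  (fcons (row_mx (- t)%:M ((1 - s) *: h)) (fun j => row_mx 0 (g (lift ord0 j)))).
have sumE (z : 'I_d.+2 -> R) : \sum_i z i *: g' i = row_mx
    ((z ord0 - z (lift ord0 ord0)) * t)%:M
    ((z ord0 * s + z (lift ord0 ord0) * (1 - s)) *: h +
      \sum_j z (lift ord0 (lift ord0 j)) *: g (lift ord0 j)).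
  rewrite !big_ord_recl [g' ord0]fcons0 [g' (lift ord0 ord0)]fconsS fcons0 !scale_row_mx.
  rewrite (eq_bigr (fun j => row_mx 0 (z (lift ord0 (lift ord0 j)) *: g (lift ord0 j)))).
    have -> (F : 'I_d -> 'rV[R]_d) : \sum_j row_mx 0 (F j) = row_mx 0 (\sum_j F j) :> 'rV_(1 + d).
      apply: (big_ind2 (fun u v => u = row_mx 0 v)) => [|_ v _ w -> ->|//].
        by rewrite row_mx0.
      by rewrite add_row_mx addr0.
    rewrite !add_row_mx addr0 addrA !scalerA -scalerDl; congr row_mx.
    by rewrite !scale_scalar_mx -raddfD/= mulrN -mulrBl.
  by move=> j _; rewrite [g' _]fconsS fconsS scale_row_mx scaler0.
exists g'.
  split.
    under eq_bigr do rewrite -[g' _]scale1r.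
    rewrite sumE subrr mul0r !mul1r [s + _]addrC subrK scale1r.
    under eq_bigr do rewrite scale1r.
    by rewrite -(big_ord_recl _ (fun i => g i)) g0 raddf0 row_mx0.
  (* Since [t] is nonzero, the new coordinate forces equal coefficients on the two new sides; what
     remains is a relation of [g]. *)
  move=> z; rewrite sumE => e.
  have := congr1 (@lsubmx R 1 1 d) e; rewrite row_mxKl raddf0 => z01.
  have := congr1 (@rsubmx R 1 1 d) e; rewrite row_mxKr raddf0 => zg.
  have z1 : z (lift ord0 ord0) = z ord0.
    move/matrixP: z01 => /(_ 0 0)/eqP; rewrite !mxE eqxx mulr1n mulf_eq0.
    by rewrite (negbTE t0) orbF subr_eq0 => /eqP.
  have := gK (fun i => z (lift ord0 i)).
  rewrite big_ord_recl z1 -[X in X *: _](_ : z ord0 * s + z (lift ord0 ord0) * (1 - s) = _).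
    move=> /(_ zg) zz.
    suff zE i : z i = z ord0 by move=> i j; rewrite !zE.
    by case: (unliftP ord0 i) => [j|] ->//; rewrite (zz j ord0).
  by rewrite z1; ring.
have nE (b : R) (v : 'rV_d) : @normrv R d.+1 (row_mx b%:M v) = Num.sqrt (b ^+ 2 + dotrv v v).
  rewrite -[LHS]/(@normrv R (1 + d) (row_mx b%:M v)) /normrv dotrv_row_mx.
  by rewrite [dotrv b%:M _]/dotrv big_ord1 !mxE eqxx mulr1n.
move=> i; case: (unliftP ord0 i) => [j|] ->; last first.
  rewrite [g' _]fcons0 nE dotrvZl dotrvZr hc mulrA -expr2 tp fcons0.
  by rewrite sqrtr_sqr gtr0_norm.
rewrite [g' _]fconsS fconsS; case: (unliftP ord0 j) => [k|] ->; last first.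
  rewrite !fcons0 nE dotrvZl dotrvZr hc sqrrN mulrA -expr2 tq.
  by rewrite sqrtr_sqr gtr0_norm.
rewrite !fconsS -[X in row_mx X _](_ : 0%:M = 0) ?nE ?raddf0//.
by rewrite expr0n add0r -[LHS]/(normrv _) gn fconsS.
Qed.

Lemma closed_spanning_digon (c : R) : 0 < c ->
  exists2 g : 'I_2 -> 'rV[R]_1, closed_spanning g & forall i, normrv (g i) = c.
Proof.
move=> c0; exists (fun i => (-1) ^+ i *: const_mx c).
  split; first by rewrite !big_ord_recl big_ord0 expr0 expr1 scale1r scaleN1r addr0 subrr.
  move=> z; rewrite !big_ord_recl big_ord0 expr0 expr1 scale1r scaleN1r addr0.
  rewrite scalerN -scalerBl => /matrixP/(_ 0 0)/eqP; rewrite !mxE mulf_eq0.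
  rewrite (gt_eqF c0) orbF subr_eq0 => /eqP z01.
  have zE i : z i = z ord0.
    by case: (unliftP ord0 i) => [j|] ->//; rewrite z01 ord1.
  by move=> i j; rewrite !zE.
move=> i; rewrite normrvZ normrX normrN1 expr1n mul1r.
by rewrite /normrv /dotrv big_ord1 !mxE -expr2 sqrtr_sqr gtr0_norm.
Qed.

(** Provides the length of the diagonal in the folding induction. *)
Lemma finite_between (I : finType) (f : I -> R) (l u : R) : l < u ->
  (forall i, f i < u) -> exists c, [/\ l < c, c < u & forall i, f i < c].
Proof.
move=> lu fu; pose m := \big[Num.max/l]_i f i.
have mu : m < u by apply/bigmax_ltP.
have lm : l <= m by exact: bigmax_ge_id.
exists ((m + u) / 2); split; [lra | lra | move=> i].
have : f i <= m by exact: le_bigmax.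
by lra.
Qed.

(** Induction on the number of sides: a diagonal of length [c] replaces the first two sides, and
    [closed_spanning_split] restores them. *)
Theorem closed_spanning_exists d (a : 'I_d.+3 -> R) :
  (forall i, 0 < a i /\ 2 * a i < \sum_j a j) ->
  exists2 g : 'I_d.+3 -> 'rV[R]_d.+2, closed_spanning g &
    forall i, normrv (g i) = a i.
Proof.
elim: d a => [|d IH] a a_ineq.
  (* For a triangle the diagonal is the third side, and the digon with both sides of that length is
     split. *)
  have := (a_ineq ord0, a_ineq (lift ord0 ord0), a_ineq (lift ord0 (lift ord0 ord0))).
  rewrite !big_ord_recl big_ord0 addr0.
  set p := a ord0; set q := a (lift ord0 ord0).
  set c := a (lift ord0 (lift ord0 ord0)) => -[[[p0 pS] [q0 qS]] [c0 cS]].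
  have [g gP gc] := closed_spanning_digon c0.
  have pqc : `|p - q| < c by rewrite ltr_norml; apply/andP; split; lra.
  have cpq : c < p + q by lra.
  have [|g' g'P g'n] := closed_spanning_split (a := fun=> c) gP _ p0 q0 pqc cpq.
    by move=> i; rewrite gc /fcons; case: unlift.
  exists g' => // i; rewrite g'n; case: (unliftP ord0 i) => [j|] ->.
    rewrite fconsS; case: (unliftP ord0 j) => [k|] ->; last by rewrite fcons0.
    by rewrite fconsS (ord1 k).
  by rewrite fcons0.
pose b j := a (lift ord0 (lift ord0 j)); pose S := \sum_j b j.
pose p := a ord0; pose q := a (lift ord0 ord0).
have aS : \sum_j a j = p + (q + S) by rewrite 2!big_ord_recl.
have [p0 pS] : 0 < p /\ 2 * p < p + (q + S) by rewrite -aS; exact: a_ineq.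
have [q0 qS] : 0 < q /\ 2 * q < p + (q + S) by rewrite -aS; exact: a_ineq.
have b0 j : 0 < b j by have [] := a_ineq (lift ord0 (lift ord0 j)).
have bS j : 2 * b j < p + (q + S).
  by have [_] := a_ineq (lift ord0 (lift ord0 j)); rewrite aS.
have bltS j : b j < S.
  have [i ij] : exists i : 'I_d.+2, i != j.
    have [->|j0] := eqVneq j ord0; first by exists (lift ord0 ord0).
    by exists ord0; rewrite eq_sym.
  rewrite /S (bigD1 j)//= ltrDl (bigD1 i)//=; apply: (lt_le_trans (b0 i)).
  by rewrite lerDl sumr_ge0// => l _; exact: ltW.
(* The diagonal must form a triangle with [p] and [q], be shorter than the sum [S] of the other
   sides, and satisfy 2 b_j < c + S for each of them. *)
have [||c [pqc cU bc]] := @finite_between _ (fun j => 2 * b j - S) `|p - q| (Num.min (p + q) S).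
- by rewrite lt_min !ltr_norml; apply/andP; split; apply/andP; split; lra.
- by move=> j; have := bS j; have := bltS j; rewrite lt_min => ? ? /=; apply/andP; split; lra.
move: cU; rewrite lt_min => /andP[cpq cS].
have c0 : 0 < c by rewrite (le_lt_trans _ pqc).
have [i|g gP gn] := IH (fcons c b).
  have -> : \sum_j fcons c b j = c + S.
    by rewrite big_ord_recl fcons0; under eq_bigr do rewrite fconsS.
  case: (unliftP ord0 i) => [j|] ->; last by rewrite fcons0; split=> //; lra.
  by rewrite fconsS; split=> //; have := bc j => /=; lra.
have [g' g'P g'n] := closed_spanning_split gP gn p0 q0 pqc cpq.
exists g' => // i; rewrite g'n; case: (unliftP ord0 i) => [j|] ->.
  rewrite fconsS; case: (unliftP ord0 j) => [k|] ->; last by rewrite fcons0.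
  by rewrite fconsS.
by rewrite fcons0.
Qed.

End polygon.

(** * Facet volume vectors *)

Section facet_volumes.
Context {R : realType}.

(** The matrix identity reads x_j.g_i + c_i = [j = i]; differences of vertices eliminate the
    constant term c_i. *)
Lemma dual_simplex_mx d (x : 'I_d.+1 -> 'rV[R]_d) (c : 'rV[R]_d.+1)
    (G : 'M[R]_(d, d.+1)) i a b :
  row_mx (const_mx 1) (\matrix_j x j) *m col_mx c G = 1%:M ->
  dotrv (x a - x b) (col i G)^T = (a == i)%:R - (b == i)%:R.
Proof.
rewrite mul_row_col => cG.
have E j : dotrv (x j) (col i G)^T = (j == i)%:R - c 0 i.
  have := congr1 (fun M : 'M[R]_d.+1 => M j i) cG.
  rewrite mxE [X in X + _]mxE big_ord1 mxE mul1r [RHS]mxE => <-.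
  rewrite addrC addrK dotrvE trmxK !mxE; apply: eq_bigr => l _.
  by rewrite !mxE.
by rewrite dotrvBl !E opprB addrA subrK.
Qed.

Lemma sum_scale_col d n (G : 'M[R]_(d, n)) (z : 'I_n -> R) :
  \sum_i z i *: (col i G)^T = (G *m \col_i z i)^T.
Proof.
apply/rowP => j; rewrite summxE !mxE; apply: eq_bigr => i _.
by rewrite !mxE mulrC.
Qed.

Lemma barycentric_gradients d (x : 'I_d.+1 -> 'rV[R]_d) :
  affinely_independent x -> exists2 g : 'I_d.+1 -> 'rV[R]_d, closed_spanning g &
    forall i a b, dotrv (x a - x b) (g i) = (a == i)%:R - (b == i)%:R.
Proof.
move=> /affinely_independent_unitmx xU.
pose C : 'M[R]_(1 + d, d.+1) := invmx (simplex_mx x).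
have CE : C = col_mx (usubmx C) (dsubmx C) by rewrite vsubmxK.
have BC : simplex_mx x *m C = 1%:M := mulmxV xU.
have CB : C *m simplex_mx x = 1%:M := mulVmx xU.
exists (fun i => (col i (dsubmx C))^T); last first.
  by move=> i a b; apply: (@dual_simplex_mx _ _ (usubmx C)); rewrite vsubmxK.
split.
  have C0 : dsubmx C *m const_mx 1 = 0 :> 'cV[R]_d.
    move: CB; rewrite CE mul_col_row [1%:M]scalar_mx_block.
    by move=> /eq_block_mx[_ _]; rewrite -CE.
  under eq_bigr do rewrite -[_^T]scale1r.
  rewrite sum_scale_col (_ : \col_(i < d.+1) 1 = const_mx 1) ?C0 ?trmx0//.
  by apply/colP => i; rewrite !mxE.
move=> z; rewrite sum_scale_col -[0]trmx0 => /trmx_inj Cz.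
(* A vector killed by the gradients is recovered from the first column of [simplex_mx x] alone,
   which is constant. *)
have zE : \col_i z i = const_mx 1 *m (usubmx C *m \col_i z i).
  rewrite -[LHS]mul1mx -BC -mulmxA CE mul_col_mx Cz /simplex_mx.
  by rewrite mul_row_col mulmx0 addr0 -CE.
have zc i : z i = (usubmx C *m \col_i z i) 0 0.
  have := congr1 (fun v : 'cV[R]_d.+1 => v i 0) zE.
  by rewrite mxE => ->; rewrite mxE big_ord1 mxE mul1r.
by move=> i j; rewrite !zc.
Qed.

Lemma simplex_of_gradients d (g : 'I_d.+1 -> 'rV[R]_d) : closed_spanning g ->
  exists2 x : 'I_d.+1 -> 'rV[R]_d, affinely_independent x &
    forall i a b, dotrv (x a - x b) (g i) = (a == i)%:R - (b == i)%:R.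
Proof.
move=> [g0 gK]; pose G : 'M[R]_(d, d.+1) := \matrix_(r, i) g i 0 r.
have gG i : g i = (col i G)^T by apply/rowP => r; rewrite !mxE.
(* A row with coordinate sum 1 completes [G] to an invertible matrix; this one places the centroid
   of the simplex at the origin. *)
pose c : 'rV[R]_d.+1 := const_mx d.+1%:R^-1.
have c1 : c *m const_mx 1 = 1%:M :> 'M[R]_1.
  apply/matrixP => i j; rewrite !ord1 !mxE eqxx.
  under eq_bigr do rewrite !mxE mulr1.
  by rewrite sumr_const card_ord -[LHS]mulr_natl divff// pnatr_eq0.
pose C : 'M[R]_(1 + d) := col_mx c G.
have CU : C \in unitmx.
  rewrite -unitmx_tr -row_free_unit; apply/inj_row_free => v /(congr1 trmx).
  rewrite trmx_mul trmxK trmx0 mul_col_mx -[X in _ = X -> _]col_mx0.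
  move=> /eq_col_mx[cv Gv].
  have vE : v^T = \col_i v 0 i by apply/colP => i; rewrite !mxE.
  have vK : forall i j, v 0 i = v 0 j.
    apply: gK; under eq_bigr do rewrite gG.
    by rewrite sum_scale_col -vE Gv trmx0.
  have vc : v^T = v 0 0 *: const_mx 1.
    by apply/colP => i; rewrite !mxE mulr1; exact: vK.
  move: cv; rewrite vc -scalemxAr c1 => /matrixP/(_ 0 0).
  rewrite !mxE eqxx mulr1 => v0; apply/rowP => i; rewrite [RHS]mxE.
  by rewrite -v0; exact: vK.
have G1 : G *m const_mx 1 = 0 :> 'cV[R]_d.
  apply: trmx_inj; rewrite trmx0 -g0.
  under [RHS]eq_bigr do rewrite gG -[_^T]scale1r.
  by rewrite sum_scale_col; congr (_ *m _)^T; apply/colP => i; rewrite !mxE.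
pose B := invmx C.
(* [C] sends the all-one column to the first basis vector, so the first column of its inverse is all
   ones, as in a [simplex_mx]. *)
have BE : B = row_mx (const_mx 1) (rsubmx B).
  rewrite -[LHS]hsubmxK; congr row_mx.
  rewrite -[RHS]mul1mx -(mulVmx CU) -mulmxA mul_col_mx c1 G1 -/B.
  by rewrite -{2}(hsubmxK B) mul_row_col mulmx1 mulmx0 addr0.
pose x j : 'rV[R]_d := row j (rsubmx B : 'M[R]_(d.+1, d)).
have xE : \matrix_j x j = rsubmx B by apply/row_matrixP => j; rewrite rowK.
exists x.
  by apply/affinely_independent_unitmx; rewrite /simplex_mx xE -BE unitmx_inv.
move=> i a b; rewrite gG; apply: (@dual_simplex_mx _ _ c).
by rewrite xE -BE mulVmx.
Qed.

Lemma root_exists n (b : R) : 0 < b -> exists2 t : R, 0 < t & t ^+ n.+1 = b.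
Proof.
move=> b0; exists (b `^ n.+1%:R^-1); first exact: powR_gt0.
by rewrite -powR_mulrn ?powR_ge0// -powRrM mulVf ?pnatr_eq0// powRr1// ltW.
Qed.

Theorem VOL_polygon k : VOL k.+2 =
  [set a : 'rV[R]_k.+3 | forall i, 0 < a 0 i /\ 2 * a 0 i < \sum_j a 0 j].
Proof.
have kappa0 := (@volume_std_simplex R k.+1).2.
apply/seteqP; split => [a [x xI xa] i|a a_ineq].
  have [g gP xg] := barycentric_gradients xI.
  pose c := `|\det (simplex_mx x)| * std_volume k.+1.
  have c0 : 0 < c.
    rewrite mulr_gt0// normr_gt0 -unitfE -unitmxE.
    exact/affinely_independent_unitmx.
  have aE j : a 0 j = c * normrv (g j).
    have := xa j; rewrite (flat_volume_facet xI (xg j)) => -[<-].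
    by rewrite /c mulrAC.
  have [gi0 giS] := polygon_inequality i isT gP.
  rewrite aE mulr_gt0//; split=> //; under eq_bigr do rewrite aE.
  by rewrite -mulr_sumr mulrCA ltr_pM2l.
have [g gP ga] := closed_spanning_exists a_ineq.
have [x xI xg] := simplex_of_gradients gP.
have D0 : 0 < `|\det (simplex_mx x)|.
  by rewrite normr_gt0 -unitfE -unitmxE; exact/affinely_independent_unitmx.
(* Scaling by [t] multiplies facet volumes by t^(d-1), with d - 1 = k + 1; this [t] turns the
   proportionality factor into 1. *)
have [|t t0 tE] := @root_exists k (`|\det (simplex_mx x)| * std_volume k.+1)^-1.
  by rewrite invr_gt0 mulr_gt0.
pose x' i := t *: x i.
have x'I : affinely_independent x'.
  move=> c c0 cx; apply: xI => //.
  have : t *: (\sum_i c i *: x i) = 0.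
    rewrite scaler_sumr -[RHS]cx; apply: eq_bigr => i _.
    by rewrite !scalerA mulrC.
  by move/eqP; rewrite scaler_eq0 gt_eqF//= => /eqP.
have x'D : \det (simplex_mx x') = t ^+ k.+2 * \det (simplex_mx x).
  rewrite !det_simplex_mx -detZ; congr (\det _).
  by apply/matrixP => i j; rewrite !mxE; ring.
exists x' => // i; rewrite (@flat_volume_facet _ _ _ _ (t^-1 *: g i))//.
  rewrite normrvZ ga x'D normrM; congr (_%:E).
  rewrite (gtr0_norm (exprn_gt0 k.+2 t0)) [`|t^-1|]gtr0_norm ?invr_gt0// exprS tE.
  by field; rewrite !gt_eqF.
by move=> u v; rewrite -scalerBr dotrvZl dotrvZr mulVKf ?lt0r_neq0//.
Qed.

End facet_volumes.

(** * The polar of the polytope *)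

Section polar.
Context {R : realType}.

Lemma convex_hull_dotrv_le n (A : set 'rV[R]_n) (y : 'rV[R]_n) (r : R) :
  (forall x, convex_hull A x -> dotrv x y <= r) <-> (forall x, A x -> dotrv x y <= r).
Proof.
split=> [h x Ax|h]; first by apply: h; exact: sub_gen_smallest.
apply: (@smallest_sub _ _ A [set x | dotrv x y <= r]) => //.
move=> u v l; rewrite !inE /= => ur vr.
rewrite -[X in dotrv X](_ : l%:num *: (u : 'rV_n) + (1 - l%:num) *: (v : 'rV_n) = _)//.
rewrite dotrvDl !dotrvZl.
have l0 : 0 <= l%:num by [].
have l1 : 0 <= 1 - l%:num by rewrite subr_ge0.
rewrite (_ : r = l%:num * r + (1 - l%:num) * r); last by ring.
by apply: lerD; apply: ler_wpM2l.
Qed.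

Lemma dotrv_delta_barycenter d (y : 'rV[R]_d.+1) i : hyperplaneW d.+1 y ->
  dotrv (delta_mx 0 i - barycenter d) y = y 0 i.
Proof.
move=> y0; rewrite dotrvBl [X in X - _](_ : _ = y 0 i); last first.
  rewrite /dotrv (bigD1 i)//= mxE !eqxx mul1r big1 ?addr0// => j /negbTE ji.
  by rewrite mxE ji andbF mul0r.
rewrite /dotrv; under eq_bigr do rewrite mxE.
by rewrite -mulr_sumr y0 mulr0 subr0.
Qed.

(** On [W] the i-th vertex of [Delta] pairs with [y] to [y 0 i], so the support function of [Delta]
    is the largest coordinate. *)
Lemma Delta_dotrv_le d (y : 'rV[R]_d.+1) (r : R) : hyperplaneW d.+1 y ->
  (forall x, Delta d x -> dotrv x y <= r) <-> forall i, y 0 i <= r.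
Proof.
move=> y0; rewrite convex_hull_dotrv_le; split=> [h i|h _ [i _ <-]].
  by rewrite -(dotrv_delta_barycenter i y0); apply: h; exists i.
by rewrite dotrv_delta_barycenter.
Qed.

Lemma polarW_polytopeP d : (2 <= d)%N -> polarW (polytopeP d) =
  [set y : 'rV[R]_d.+1 | hyperplaneW d.+1 y /\
    forall i, - d.+1%:R^-1 <= y 0 i /\ y 0 i <= 2^-1 - d.+1%:R^-1].
Proof.
move=> d2; have d1 : 0 < d.+1%:R :> R by rewrite ltr0n.
have dm1 : 0 < d%:R - 1 :> R by rewrite subr_gt0 ltr1n.
pose c := (2 * d + 2)%:R / (d%:R - 1) : R.
have c0 : 0 < c by rewrite divr_gt0// ltr0n addn2.
(* Translation by 1/(d+1) in each coordinate turns this upper bound into 1/2, and the lower bound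
   coming from the other simplex into 0. *)
have cV : c^-1 = 2^-1 - d.+1%:R^-1.
  rewrite /c natrD natrM -natr1; field.
  by rewrite !gt_eqF// -?natr1; lra.
have key (y x : 'rV[R]_d.+1) :
    (dotrv (c *: x) y <= 1) = (dotrv x y <= c^-1) /\
    (dotrv (d.+1%:R *: - x) y <= 1) = (dotrv x (- y) <= d.+1%:R^-1).
  rewrite -scaleN1r scalerA !dotrvZl -[- y]scaleN1r dotrvZr mulrN1 mulN1r mulNr -mulrN.
  by rewrite -[c^-1]mulr1 -[d.+1%:R^-1]mulr1 !ler_pdivlMl.
have oppW (y : 'rV[R]_d.+1) : hyperplaneW d.+1 y -> hyperplaneW d.+1 (- y).
  move=> yW; rewrite /hyperplaneW/=; under eq_bigr do rewrite mxE.
  by rewrite sumrN yW oppr0.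
apply/seteqP; split=> y /= [yW yP]; have nyW := oppW _ yW; split=> //.
  move: yP; rewrite convex_hull_dotrv_le => yP i.
  have hi : forall x, Delta d x -> dotrv x y <= c^-1.
    by move=> x xD; rewrite -(key y x).1; apply: yP; left; exists x.
  have lo : forall x, Delta d x -> dotrv x (- y) <= d.+1%:R^-1.
    by move=> x xD; rewrite -(key y x).2; apply: yP; right; exists x.
  move: hi lo; rewrite !Delta_dotrv_le// => /(_ i) hi /(_ i).
  by rewrite mxE lerNl -cV.
rewrite convex_hull_dotrv_le => _ [[x xD <-]|[x xD <-]].
  rewrite (key y x).1; move: x xD; apply/Delta_dotrv_le => // i.
  by rewrite cV; have [] := yP i.
rewrite (key y x).2; move: x xD; apply/Delta_dotrv_le => // i.
by rewrite mxE lerNl; have [] := yP i.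
Qed.

(** The box is a neighbourhood of 0 in [W], so its affine hull is [W] and the relative interior is
    the interior within [W]. *)
Lemma relint_box n (l u : R) : (1 < n)%N -> 0 < l -> 0 < u ->
  relint [set y : 'rV[R]_n | hyperplaneW n y /\ forall i, - l <= y 0 i /\ y 0 i <= u] =
  [set y | hyperplaneW n y /\ forall i, - l < y 0 i /\ y 0 i < u].
Proof.
move=> n1 l0 u0; set A := [set y | _ /\ _].
have hullA : affine_hull A = hyperplaneW n.
  apply/seteqP; split=> y /=.
    move=> [m [x [c [xA c1 ->]]]]; rewrite /hyperplaneW/=.
    under eq_bigr do rewrite summxE.
    rewrite exchange_big big1// => j _.
    under eq_bigr do rewrite mxE.
    by rewrite -mulr_sumr; have [-> _] := xA j; rewrite mulr0.
  move=> yW; pose M := \sum_i `|y 0 i|.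
  have M0 : 0 <= M by exact: sumr_ge0.
  have yM i : `|y 0 i| <= M by rewrite /M (bigD1 i)//= lerDl sumr_ge0.
  (* Large enough for [t^-1 *: y] to lie in the box; [y] is the affine combination of this point and
     0 with coefficients [t] and [1 - t]. *)
  pose t := 1 + M / l + M / u.
  have Ml : 0 <= M / l by rewrite divr_ge0// ltW.
  have Mu : 0 <= M / u by rewrite divr_ge0// ltW.
  have t0 : 0 < t by rewrite /t; lra.
  exists 2%N, (fun i : 'I_2 => if i == ord0 then t^-1 *: y else 0).
  exists (fun i : 'I_2 => if i == ord0 then t else 1 - t); split.
  - move=> i; case: ifP => _; split.
    + rewrite /hyperplaneW/=; under eq_bigr do rewrite mxE.
      by rewrite -mulr_sumr yW mulr0.
    + move=> j; rewrite mxE; have := yM j; rewrite ler_norml => /andP[yj1 yj2].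
      rewrite ler_pdivrMl// ler_pdivlMl//.
      have tl : M <= t * l.
        rewrite /t -ler_pdivrMr//; lra.
      have tu : M <= t * u by rewrite /t -ler_pdivrMr//; lra.
      by split; lra.
    + by rewrite /hyperplaneW/= big1// => j _; rewrite mxE.
    + by move=> j; rewrite mxE; split; lra.
  - by rewrite !big_ord_recl big_ord0/= addr0 addrC subrK.
  by rewrite !big_ord_recl big_ord0/= scaler0 !addr0 scalerA divff ?scale1r ?lt0r_neq0.
rewrite /relint hullA; apply/seteqP; split=> y /=.
  move=> yA; have [yW yb] : A y by exact: (nbhs_subspace_singleton yA).
  have {}yA : within (hyperplaneW n) (nbhs y) A by rewrite (nbhs_subspace_in yW).
  have [e e0 eA] : exists2 e : R, 0 < e & forall z, hyperplaneW n z ->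
      (forall i, `|y 0 i - z 0 i| < e) -> A z.
    have /nbhs_ballP[e e0 eA] := yA; exists e => // z zW yz.
    by apply: eA => //; split=> // i j; rewrite ord1; exact: yz.
  (* Moving [e / 2] from one coordinate to another stays in [W] but leaves [A]
     if a bound is attained. *)
  have move_coord i s : `|s| = 1 -> - l <= y 0 i + s * (e / 2) /\ y 0 i + s * (e / 2) <= u.
    move=> s1; pose j : 'I_n := if i == Ordinal (ltnW n1) then Ordinal n1 else Ordinal (ltnW n1).
    have ji : j != i by rewrite /j; case: ifPn => [/eqP->|]; rewrite // eq_sym.
    pose z := y + (s * (e / 2)) *: (delta_mx 0 i - delta_mx 0 j).
    have [|k|_ /(_ i)] := eA z.
    - rewrite /hyperplaneW/= /z; under eq_bigr do rewrite mxE.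
      rewrite big_split/= yW add0r; under eq_bigr do rewrite !mxE eqxx/=.
      rewrite -mulr_sumr sumrB (bigD1 i)//= eqxx big1 ?addr0 => [|k /negbTE ->//].
      rewrite (bigD1 j)//= eqxx big1 ?addr0 => [|k /negbTE ->//].
      by rewrite subrr mulr0.
    - have -> : y 0 k - z 0 k = - (s * (e / 2) * ((k == i)%:R - (k == j)%:R)).
        by rewrite /z !mxE eqxx/=; ring.
      rewrite normrN normrM normrM s1 mul1r.
      rewrite gtr0_norm ?divr_gt0//.
      have : `|(k == i)%:R - (k == j)%:R| <= 1 :> R.
        by case: (k == i); case: (k == j); rewrite ?subrr ?subr0 ?sub0r ?normrN ?normr1 ?normr0.
      move=> h; apply: (@le_lt_trans _ _ (e / 2 * 1)); last by lra.
      by apply: ler_wpM2l => //; lra.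
    by rewrite /z !mxE !eqxx (eq_sym i) (negbTE ji) subr0 mulr1.
  split=> // i.
  have [_] := move_coord i 1 (normr1 _).
  have [+ _] := move_coord i (-1) (normrN1 _).
  by lra.
move=> [yW yb].
suff : within (hyperplaneW n) (nbhs y) A by rewrite (nbhs_subspace_in yW).
(* The smallest slack in the strict inequalities, capped at 1, serves as radius. *)
pose m := \big[Num.min/1]_i Num.min (y 0 i + l) (u - y 0 i).
have m0 : 0 < m.
  apply/bigmin_gtP; split=> // i _; rewrite lt_min.
  by have [] := yb i; move=> *; apply/andP; split; lra.
apply/nbhs_ballP; exists m => //= z [_ yz] zW; split=> // i.
have := yz 0 i; rewrite /ball/= ltr_norml => /andP[yz1 yz2].
have : m <= Num.min (y 0 i + l) (u - y 0 i) by exact: bigmin_le.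
by rewrite le_min => /andP[m1 m2]; split; lra.
Qed.

End polar.

Theorem corollary1p2 (R : realType) (d : nat) (hd : (2 <= d)%N) :
  let Q : set 'rV[R]_d.+1 :=
    [set y + barycenter d | y in relint (polarW (polytopeP d))] in
  VOL d `&` hyperplaneH d.+1 = Q /\ VOL d = cone Q `\ 0.
Proof.
set Q : set _ := [set _ | y in _]; move=> /=.
have d1 : 0 < d.+1%:R :> R by rewrite ltr0n.
have hi0 : 0 < 2^-1 - d.+1%:R^-1 :> R.
  by rewrite subr_gt0 ltf_pV2 ?posrE// ltr_nat ltnS.
have QE : Q = [set a | \sum_i a 0 i = 1 /\ forall i, 0 < a 0 i /\ 2 * a 0 i < 1].
  have sb : \sum_i barycenter d 0 i = 1 :> R.
    under eq_bigr do rewrite mxE.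
    by rewrite sumr_const card_ord -[LHS]mulr_natl divff// lt0r_neq0.
  rewrite /Q polarW_polytopeP// relint_box ?invr_gt0//; last exact: leqW.
  apply/seteqP; split=> [_ [y [yW yb] <-]|a [a1 ab]].
    split; first by under eq_bigr do rewrite mxE; rewrite big_split/= yW sb add0r.
    move=> i; rewrite !mxE; have [] := yb i.
    by move: (d.+1%:R^-1) (y 0 i) => v w vw wv; split; lra.
  exists (a - barycenter d); last by rewrite subrK.
  have aE i : (a - barycenter d) 0 i = a 0 i - barycenter d 0 i by rewrite !mxE.
  split; first by rewrite /hyperplaneW/=; under eq_bigr do rewrite aE;
    rewrite sumrB a1 sb subrr.
  move=> i; rewrite !mxE; have [] := ab i.
  by move: (d.+1%:R^-1) (a 0 i) => v w vw wv; split; lra.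
have VE : VOL d = [set a : 'rV[R]_d.+1 | forall i, 0 < a 0 i /\ 2 * a 0 i < \sum_j a 0 j].
  by case: d hd {Q QE d1 hi0} => [|[|k]]// _; exact: VOL_polygon.
rewrite VE QE; split.
  apply/seteqP; split=> [a [ab a1]|a [a1 ab]].
    by split=> // i; have := ab i; rewrite a1.
  by split=> // i; rewrite a1.
apply/seteqP; split=> [a ab|a [[m [x [c [xQ c0 ->]]]] sN0]].
  have S0 : 0 < \sum_j a 0 j.
    by have [a0 aS] := ab ord0; apply: lt_trans aS; rewrite mulr_gt0.
  split; last by move=> a0; have [+ _] := ab ord0; rewrite a0 mxE ltxx.
  (* The inequalities are homogeneous, so dividing by the coordinate sum lands in [Q]. *)
  exists 1%N, (fun=> (\sum_j a 0 j)^-1 *: a), (fun=> \sum_j a 0 j); split.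
  - move=> _; split=> [|i]; first by under eq_bigr do rewrite mxE;
      rewrite -mulr_sumr mulVf ?lt0r_neq0.
    rewrite mxE mulrCA mulr_gt0 ?invr_gt0 ?(ab i).1//; split=> //.
    by rewrite ltr_pdivrMl// mulr1 (ab i).2.
  - by move=> _; exact: ltW.
  by rewrite big_ord1 scalerA divff ?scale1r// lt0r_neq0.
(* The combination is nonzero, so some coefficient is positive; strict linear inequalities then
   survive the summation. *)
have [j cj] : exists j, 0 < c j.
  apply: contrapT => /forallNP cN; apply: sN0 => /=; apply: big1 => j _.
  suff -> : c j = 0 by rewrite scale0r.
  by apply/le_anti; rewrite c0 andbT leNgt; apply/negP/cN.
have cS (f : 'I_m -> R) : (forall k, 0 < f k) -> 0 < \sum_k c k * f k.
  move=> f0; rewrite (bigD1 j)//=; apply: (@lt_le_trans _ _ (c j * f j)).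
    exact: mulr_gt0.
  by rewrite lerDl sumr_ge0// => k _; rewrite mulr_ge0// ltW.
have coord i : (\sum_k c k *: x k) 0 i = \sum_k c k * x k 0 i.
  by rewrite summxE; apply: eq_bigr => k _; rewrite mxE.
move=> i; split; first by rewrite coord; apply: cS => k; have [_ /(_ i)[]] := xQ k.
(* The slack in the polygon inequality is linear, and at each generator it is 1 - 2 x_i. *)
rewrite -subr_gt0; under eq_bigr do rewrite coord.
rewrite exchange_big/= coord mulr_sumr -sumrB.
rewrite (eq_bigr (fun k => c k * (1 - 2 * x k 0 i))) => [|k _].
  by apply: cS => k; have [_ /(_ i)[_]] := xQ k; rewrite subr_gt0.
by rewrite -mulr_sumr; have [-> _] := xQ k; ring.
Qed.
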